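(* Let $p$ be a prime, $F$ a field of characteristic $p$, and suppose $G=G_+$. Let $L=L(X)$ be the free color Lie $p$-algebra generated by a $\Lambda$-graded set $X=\bigcup_{\lambda\in\Lambda}X_\lambda$ with $|X_\lambda|<\infty$ for all $\lambda\in\Lambda=\Lambda_+$. Then, in $\mathbb{Q}[[\Lambda]]$, $$\mathrm{ch}_\Lambda L(X)=-\sum_{n=1}^{\infty}\frac{\mu_p(n)}{n}\ln\bigl(1-\mathrm{ch}_\Lambda^{[n]}X\bigr),$$ where $\mathrm{ch}_\Lambda^{[n]}X=(\mathrm{ch}_\Lambda X)^{[n]}$.
   Context: $\mathbb{N}=\{1,2,\dots\}$; $\mu$ is the Möbius function. Define $\mu_p(n)=\mu(n)$ if $p\nmid n$, and $\mu_p(n)=\mu(m)(p^s-p^{s-1})$ if $n=mp^s$ with $p\nmid m$, $s\ge1$. Color Lie $p$-algebras: $G$ is an abelian group (written multiplicatively), $\gamma:G\times G\to F^{\times}$ a bicharacter with $\gamma(g,h)\gamma(h,g)=1$; $G_+=\{g:\gamma(g,g)=1\}$, here $G=G_+$. A color Lie algebra is a $G$-graded space $L=\bigoplus_gL_g$ with bilinear bracket, $[L_g,L_h]\subseteq L_{gh}$, such that for $x\in L_g,y\in L_h,z\in L$: $[x,y]=-\gamma(g,h)[y,x]$, $[x,[y,z]]=[[x,y],z]+\gamma(g,h)[y,[x,z]]$, and $[x,x]=0$. It is a color Lie $p$-algebra if for each $g\in G$ there is a map $L_g\to L_{g^p}$, $x\mapsto x^{[p]}$, with $(ax)^{[p]}=a^px^{[p]}$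 ($a\in F$), $[x^{[p]},z]=(\mathrm{ad}\,x)^p(z)$ for all $z\in L$, and $(x+y)^{[p]}=x^{[p]}+y^{[p]}+\sum_{i=1}^{p-1}s_i(x,y)$ for $x,y\in L_g$, where $i\,s_i(x,y)$ is the coefficient of $t^{i-1}$ in $(\mathrm{ad}(tx+y))^{p-1}(x)$. The free color Lie $p$-algebra $L(X)$ on a $G$-graded set $X$ is defined by the usual universal property for $G$-degree-preserving maps. Gradings and characters: $\Lambda$ is a countable additive abelian semigroup in which every element can be written as a sum of other elements in only finitely many ways, with a homomorphism $\kappa:\Lambda\to\{\pm1\}$, $\Lambda_\pm=\{\lambda:\kappa(\lambda)=\pm1\}$; here $\Lambda=\Lambda_+$, i.e. $\kappa$ is trivial. Each element of $X_\lambda$ is $G$-homogeneous. $L(X)=\bigoplus_\lambda L_\lambda$ has the $\Lambda$-grading in which elements of $X_\lambda$ have degree $\lambda$, $[L_\lambda,L_\mu]\subseteq L_{\lambda+\mu}$ and $(L_\lambda\cap L_g)^{[p]}\subseteq L_{p\lambda}$. $\mathbb{Q}[[\Lambda]]$ is the algebra of all formal sums $\sum_\lambda f_\lambda e^\lambda$, $f_\lambda\in\mathbb{Q}$, with $e^\lambda e^\mu=e^{\lambda+\mu}$. $\mathrm{ch}_\Lambda L=\sum_\lambda(\dim L_\lambda)e^\lambda$, $\mathrm{ch}_\Lambda X=\sum_\lambda|X_\lambda|e^\lambda$. The dilation (for $\Lambda=\Lambda_+$) is $\bigl(\sum_\lambda f_\lambda e^\lambda\bigr)^{[n]}=\sum_\lambda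 f_\lambda e^{n\lambda}$. $\ln$ of a series with constant term 1 is defined by the usual power series. *)

(* Defs.v *)
From HB Require Import structures.
From mathcomp Require Import all_boot all_order all_algebra.
From mathcomp Require Import finmap.
From mathcomp Require Import boolp classical_sets functions cardinality fsbigop.

Set Implicit Arguments.
Unset Strict Implicit.
Unset Printing Implicit Defensive.
Import Order.TTheory GRing.Theory Num.Theory.
Local Open Scope classical_set_scope.
Local Open Scope ring_scope.

Definition moebius (n : nat) : int :=
  if all (fun q => logn q n == 1)%N (primes n) then (-1) ^+ size (primes n)
  else 0.

Definition moebius_p (p n : nat) : int :=
  let s := logn p n in
  if (p %| n)%N then moebius (n %/ p ^ s) * (p ^ s - p ^ s.-1)%N%:Z
  else moebius n.

Section Subspaces.
Variables (F : fieldType) (L : lmodType F).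

Definition subspace (V : set L) : Prop :=
  V 0 /\ forall (a : F) x y, V x -> V y -> V (a *: x + y).

Definition direct_decomposition (I : choiceType) (C : I -> set L) : Prop :=
  (forall i, subspace (C i)) /\
  (forall x : L, exists! f : I -> L,
     [/\ forall i, C i (f i),
         finite_set [set i | f i != 0]
       & x = \sum_(i \in [set: I]) f i]).

Definition is_basis (V : set L) (n : nat) (b : 'I_n -> L) : Prop :=
  (forall i, V (b i)) /\
  (forall x, V x -> exists! c : 'rV[F]_n, x = \sum_(i < n) c 0 i *: b i).

Definition has_dim (V : set L) (n : nat) : Prop :=
  exists b : 'I_n -> L, is_basis V b.

Definition finite_dim (V : set L) : Prop := exists n, has_dim V n.

(* Junk value 0 when V is not of finite dimension. *)
Definition dim (V : set L) : nat := xget 0%N [set n | has_dim V n].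

End Subspaces.

(* The grading group G is written additively.  The identity
   gamma g h * gamma h g = 1 forces the values to be nonzero. *)
Definition bicharacter (F : fieldType) (G : zmodType) (gamma : G -> G -> F) :=
  [/\ forall g g' h, gamma (g + g') h = gamma g h * gamma g' h,
      forall g h h', gamma g (h + h') = gamma g h * gamma g h'
    & forall g h, gamma g h * gamma h g = 1].

(* The axiom [x, x] = 0 for every homogeneous x is the one appropriate to
   G = G_+, i.e. gamma g g = 1 for all g; it is not imposed on sums of
   homogeneous elements of different degrees. *)
Record colorLie (F : fieldType) (G : zmodType) (gamma : G -> G -> F) :=
  ColorLie {
    colorLie_sort :> lmodType F;
    comp : G -> set colorLie_sort;
    br : colorLie_sort -> colorLie_sort -> colorLie_sort;
    comp_direct : direct_decomposition comp;
    br_linearl : forall y, linear (br^~ y);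
    br_linearr : forall x, linear (br x);
    br_comp : forall g h x y, comp g x -> comp h y -> comp (g + h) (br x y);
    br_skew : forall g h x y, comp g x -> comp h y ->
      br x y = - (gamma g h *: br y x);
    br_jacobi : forall g h x y z, comp g x -> comp h y ->
      br x (br y z) = br (br x y) z + gamma g h *: br y (br x z);
    br_alt : forall g x, comp g x -> br x x = 0
  }.

Section PMap.
Variables (F : fieldType) (G : zmodType) (gamma : G -> G -> F).
Variable L : colorLie gamma.
Implicit Types x y : L.

(* A polynomial \sum_k (c k) t^k with coefficients in L is encoded by
   c : nat -> L; this is ad (t x + y) acting on such polynomials. *)
Definition ad_txy x y (c : nat -> L) : nat -> L :=
  fun k => (if k is k'.+1 then br x (c k') else 0) + br y (c k).

(* i * s_i(x, y) is the coefficient of t^(i-1) in (ad (t x + y))^(p-1) (x);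
   used only for 0 < i < p, where i is invertible in characteristic p. *)
Definition s_ (p i : nat) x y : L :=
  (i%:R : F)^-1 *:
    iter p.-1 (ad_txy x y) (fun k => if k == 0%N then x else 0) i.-1.

End PMap.

(* The maps L_g -> L_(g^p) are packed in one function L -> L, whose values
   matter on homogeneous elements only: L_g and L_h meet in 0 for g != h, and
   pmap_scale forces pmap 0 = 0. *)
Record colorLieP (p : nat) (F : fieldType) (G : zmodType) (gamma : G -> G -> F)
  := ColorLieP {
    colorLieP_base :> colorLie gamma;
    pmap : colorLieP_base -> colorLieP_base;
    pmap_comp : forall g x, comp g x -> comp (g *+ p) (pmap x);
    pmap_scale : forall g (a : F) x, comp g x -> pmap (a *: x) = a ^+ p *: pmap x;
    pmap_ad : forall g x z, comp g x -> br (pmap x) z = iter p (br x) z;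
    pmap_add : forall g x y, comp g x -> comp g y ->
      pmap (x + y) = pmap x + pmap y + \sum_(1 <= i < p) s_ p i x y
  }.

Section Free.
Variables (p : nat) (F : fieldType) (G : zmodType) (gamma : G -> G -> F).

Definition is_hom (L M : colorLieP p gamma) (f : L -> M) : Prop :=
  [/\ linear f,
      forall g x, comp g x -> comp g (f x),
      forall x y, f (br x y) = br (f x) (f y)
    & forall g x, comp g x -> f (pmap x) = pmap (f x)].

Definition is_free (X : choiceType) (degG : X -> G)
    (L : colorLieP p gamma) (iota : X -> L) : Prop :=
  (forall x, comp (degG x) (iota x)) /\
  (forall (M : colorLieP p gamma) (phi : X -> M),
     (forall x, comp (degG x) (phi x)) ->
     exists! f : L -> M, is_hom f /\ forall x, f (iota x) = phi x).

End Free.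

Section FormalSums.
Variable Lam : addSemigroupType.
Implicit Types (f g : Lam -> rat) (l : Lam) (n : nat).

(* Every l is a sum s.1 + s.2_1 + ... + s.2_k of elements of Lam in finitely
   many ways.  In particular l = l + m never holds, so Lam has no neutral
   element. *)
Definition finitely_decomposable : Prop :=
  forall l, finite_set [set s : Lam * seq Lam | foldl +%R s.1 s.2 = l].

(* n l, for n >= 1 *)
Definition pmuln n l : Lam := iter n.-1 (+%R l) l.

(* An element of Q[[Lam]] is its coefficient function Lam -> rat.  When Lam is
   finitely decomposable, all the sums \sum_(_ \in _) in this section have
   finite support. *)
Definition fs_mul f g : Lam -> rat :=
  fun l => \sum_(m \in [set m : Lam * Lam | m.1 + m.2 = l]) (f m.1 * g m.2).

(* f ^ n, for n >= 1 *)
Definition fs_pow f n : Lam -> rat := iter n.-1 (fs_mul f) f.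

Definition dilation n f : Lam -> rat :=
  fun l => \sum_(m \in [set m | pmuln n m = l]) f m.

(* ln (1 + f) = \sum_(n >= 1) (-1)^(n-1) f^n / n.  As Lam has no neutral
   element, the constant term 1 is outside of Lam -> rat, hence the shift. *)
Definition ln1p f : Lam -> rat :=
  fun l => \sum_(n \in [set n : nat | (0 < n)%N])
             ((-1) ^+ n.-1 / n%:R * fs_pow f n l).

Definition ch_set (X : choiceType) (degL : X -> Lam) : Lam -> rat :=
  fun l => (#|` fset_set [set x | degL x = l]|)%:R.

Definition ch_grading (F : fieldType) (L : lmodType F) (V : Lam -> set L)
  : Lam -> rat := fun l => (dim (V l))%:R.

End FormalSums.

(* V is a grading of the space L by Lam, multiplicative for the bracket and
   the p-map, in which the generator iota x has degree degL x. *)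
Definition is_Lam_grading (p : nat) (F : fieldType) (G : zmodType)
    (gamma : G -> G -> F) (L : colorLieP p gamma) (X : choiceType)
    (iota : X -> L) (Lam : addSemigroupType) (degL : X -> Lam)
    (V : Lam -> set L) : Prop :=
  [/\ direct_decomposition V,
      forall x, V (degL x) (iota x),
      forall l m x y, V l x -> V m y -> V (l + m) (br x y)
    & forall l g x, V l x -> comp g x -> V (pmuln p l) (pmap x)].

(* Main.v *)
Require Import Defs.
From HB Require Import structures.
From mathcomp Require Import all_boot all_order all_algebra.
From mathcomp Require Import finmap.
From mathcomp Require Import boolp classical_sets functions cardinality fsbigop.
From mathcomp Require Import zify ring.
Import GRing.Theory.
Local Open Scope classical_set_scope.
Local Open Scope ring_scope.

Set Implicit Arguments.
Unset Strict Implicit.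
Unset Printing Implicit Defensive.

(** The free color Lie [p]-algebra has the same shape as the free Lie
    [p]-algebra: order the alphabet, and let [b w] be the standard bracketing of
    a Lyndon word [w]; then the iterated powers [pmap^k (b w)], for [w] Lyndon
    and [k >= 0], form a basis of [L] consisting of elements homogeneous for both
    gradings.

    They span. By the Jacobi identity, the bracket of [b u] and [b v] is a
    combination of bracketings of Lyndon words ([br_bracketing_lt]), and
    [pmap^k (b w)] acts as the iterate of [ad (b w)] of order [p ^ k]; so the
    span is closed under the bracket, under the [p]-map and under the projections
    to the [G]-components. It contains the generators, hence it is all of [L]:
    the universal property gives a morphism from [L] to this subalgebra, and its
    composite with the inclusion is the identity by uniqueness
    ([free_generated]).

    They are independent. The square matrices, suitably graded by [G], form a
    color Lie [p]-algebra for the color commutator and the associative [p]-th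
    power ([mxLieP]). For a word [W], sending a letter [x] to the sum of the
    elementary matrices [E_(i, i+1)] over the positions [i] of [x] in [W] makes
    the corner entry of a matrix read off the coefficient of [W] in an
    associative polynomial. The image of [pmap^k (b w)] has least word
    [w ^ (p ^ k)], with coefficient 1, and these words are pairwise distinct
    ([pelt_free]).

    Consequently [dim (V l)] is the number of pairs [(w, k)] such that [p ^ k]
    times the degree of [w] is [l] ([graded_has_dim]).

    On the other side, the coefficient of [l] in [- ln (1 - ch^[n])] is the sum
    of [1 / |w|] over the words [w] such that [n deg w = l]. Every nonempty word
    is, in exactly one way, a rotation by [r < |u|] of a power [u ^ d] of a Lyndon
    word [u] ([necklace_ex], [necklace_inj]), so this is the sum of [1 / d] over
    the pairs [(u, d)] with [n d deg u = l] ([necklace_sum]). Grouping the terms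
    by [D = n d] leaves the divisor sum of [moebius_p p] at [D], divided by [D],
    which is 1 when [D] is a power of [p] and 0 otherwise ([sum_moebius_p]): the
    right-hand side counts the same pairs. *)

(** * Lyndon words *)

Section Words.
Variables (T : eqType) (f : T -> nat).
Hypothesis f_inj : injective f.
Implicit Types (a b c u v w : seq T) (x y : T).

(** The strict lexicographic order, in which a proper prefix is smaller; the
    letters are compared through the injection [f] into the natural numbers. *)
Fixpoint ltw u v : bool :=
  match u, v with
  | _, [::] => false
  | [::], _ :: _ => true
  | x :: u', y :: v' => (f x < f y)%N || (x == y) && ltw u' v'
  end.

Lemma ltww u : ltw u u = false.
Proof. by elim: u => //= x u ->; rewrite ltnn andbF. Qed.

Lemma ltw_trans v u w : ltw u v -> ltw v w -> ltw u w.
Proof.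
elim: u v w => [|x u IH] [|y v] [|z w] //= /orP[h1|/andP[/eqP<- h1]].
  by case/orP => [h2|/andP[/eqP<- _]]; rewrite ?h1 // (ltn_trans h1 h2).
by case/orP => [->//|/andP[/eqP<- h2]]; rewrite eqxx (IH _ _ h1 h2) orbT.
Qed.

Lemma ltw_total u v : u != v -> ltw u v || ltw v u.
Proof.
elim: u v => [|x u IH] [|y v] //=; rewrite eqseq_cons.
case: (eqVneq x y) => [-> /= /IH|nxy _]; first by rewrite ltnn.
by case: ltngtP => // /f_inj e; rewrite e eqxx in nxy.
Qed.

Lemma ltwNgt u v : ltw u v -> ~~ ltw v u.
Proof. by move=> h; apply/negP => /(ltw_trans h); rewrite ltww. Qed.

Lemma ltw_cat2l u a b : ltw (u ++ a) (u ++ b) = ltw a b.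
Proof. by elim: u => //= x u ->; rewrite ltnn eqxx. Qed.

Lemma ltw_catr u b : b != [::] -> ltw u (u ++ b).
Proof. by elim: u => [|x u IH] /=; [case: b | rewrite eqxx orbC => /IH->]. Qed.

Lemma ltw_mismatch u v a b : ltw u v -> ~~ prefix u v -> ltw (u ++ a) (v ++ b).
Proof.
elim: u v => [|x u IH] [|y v] //= /orP[->//|/andP[/eqP-> h]].
by rewrite eqxx /= => /(IH _ h) ->; rewrite orbT.
Qed.

Lemma ltw_size_cat u v a b :
  size u = size v -> ltw u v -> ltw (u ++ a) (v ++ b).
Proof.
move=> s h; apply: ltw_mismatch => //; apply/negP => /prefixP[c e].
move: (congr1 size e); rewrite size_cat s => /esym /eqP.
rewrite -{2}[size v]addn0 eqn_add2l => /nilP c0.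
by rewrite e c0 cats0 ltww in h.
Qed.

(** A word is Lyndon when it is nonempty and smaller than its proper nonempty
    suffixes. *)
Definition lyndon w :=
  (w != [::]) && all (fun i => ltw w (drop i w)) (iota 1 (size w).-1).

Lemma lyndonP w : reflect
  (w != [::] /\ forall a b, w = a ++ b -> a != [::] -> b != [::] -> ltw w b)
  (lyndon w).
Proof.
apply: (iffP andP) => -[wn h]; split=> //.
  move=> a b e an bn; move/allP: h => /(_ (size a)).
  rewrite e drop_size_cat //; apply; rewrite mem_iota size_cat.
  by move: an bn; rewrite -!size_eq0; lia.
apply/allP => i; rewrite mem_iota => hi.
have wi : (0 < size w)%N by rewrite lt0n size_eq0.
apply: (h (take i w)); first by rewrite cat_take_drop.
  by rewrite -size_eq0 size_takel; lia.
by rewrite -size_eq0 size_drop; lia.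
Qed.

Lemma lyndon_neq0 w : lyndon w -> w != [::].
Proof. by case/andP. Qed.

Lemma lyndon_suffix a b :
  lyndon (a ++ b) -> a != [::] -> b != [::] -> ltw (a ++ b) b.
Proof. by case/lyndonP => _; apply. Qed.

Lemma lyndon_lt_suffix a b :
  lyndon (a ++ b) -> a != [::] -> b != [::] -> ltw a b.
Proof. by move=> h an bn; apply: ltw_trans (ltw_catr _ bn) (lyndon_suffix h an bn). Qed.

(** Two factorizations of a word, compared by their cutting points. *)
Lemma eq_cat_split u v a b : u ++ v = a ++ b -> (size a <= size u)%N ->
  exists2 c, u = a ++ c & b = c ++ v.
Proof.
move=> e s; exists (drop (size a) u); last first.
  move: (congr1 (drop (size a)) e); rewrite (drop_size_cat b (erefl (size a))) drop_cat.
  rewrite ltn_neqAle s andbT; case: eqP => //= ->.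
  by rewrite subnn drop0 drop_size.
move: (congr1 (take (size a)) e); rewrite (take_size_cat b (erefl (size a))) take_cat.
rewrite ltn_neqAle s andbT; case: eqP => [->|_ {1}<-] /=; last by rewrite cat_take_drop.
by rewrite subnn take0 cats0 drop_size => ->; rewrite cats0.
Qed.

(** When [u] is a prefix of [v], the rest of [v] is a suffix of the Lyndon word
    [v], hence is larger than [v]. *)
Lemma ltw_catl u v : lyndon v -> u != [::] -> ltw u v -> ltw (u ++ v) v.
Proof.
move=> hv un h; case: (boolP (prefix u v)) => [/prefixP[c e]|np].
  rewrite {2}e ltw_cat2l e; apply: lyndon_suffix => //; first by rewrite -e.
  by apply: contraTneq h => c0; rewrite e c0 cats0 ltww.
by rewrite -[X in ltw _ X]cats0; apply: ltw_mismatch.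
Qed.

Lemma lyndon_cat u v : lyndon u -> lyndon v -> ltw u v -> lyndon (u ++ v).
Proof.
move=> hu hv h; have un := lyndon_neq0 hu.
have uv := ltw_catl hv un h.
apply/lyndonP; split; first by case: (u) un.
move=> a b e an bn; case: (ltnP (size a) (size u)) => s.
  have [c eu ->] := eq_cat_split e (ltnW s).
  have cn : c != [::] by apply: contraTneq s => c0; rewrite eu c0 cats0 ltnn.
  apply: ltw_mismatch; first by rewrite {1}eu; apply: lyndon_suffix; rewrite -?eu.
  apply/negP => /size_prefix; rewrite eu size_cat.
  by move: an; rewrite -size_eq0; lia.
have [c ea ev] := eq_cat_split (esym e) s.
case: (eqVneq c [::]) => [c0|cn]; first by rewrite {2}ev c0 in uv *.
by apply: ltw_trans uv _; rewrite {1}ev; apply: lyndon_suffix; rewrite -?ev.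
Qed.

(** The start of the least proper nonempty suffix of a word. *)
Definition min_suffix w : nat :=
  (find (fun i => all (fun j => ~~ ltw (drop j w) (drop i w))
                      (iota 1 (size w).-1)) (iota 1 (size w).-1)).+1.

Lemma exists_min (s : seq (seq T)) : s != [::] ->
  exists2 m, m \in s & forall z, z \in s -> ~~ ltw z m.
Proof.
elim: s => // x s IH _; case: (eqVneq s [::]) => [->|/IH[m ms h]].
  by exists x; rewrite ?mem_head // => y; rewrite inE => /eqP->; rewrite ltww.
case: (boolP (ltw x m)) => xm.
  exists x; first exact: mem_head.
  move=> y; rewrite inE => /orP[/eqP->|/h ym]; first by rewrite ltww.
  by apply: contra ym => /ltw_trans; apply.
exists m; first by rewrite inE ms orbT.
by move=> y; rewrite inE => /orP[/eqP->|/h].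
Qed.

Lemma min_suffixP w : (1 < size w)%N ->
  [/\ (0 < min_suffix w)%N, (min_suffix w < size w)%N &
      forall j, (0 < j)%N -> (j < size w)%N ->
        ~~ ltw (drop j w) (drop (min_suffix w) w)].
Proof.
move=> sw; pose P i := all (fun j => ~~ ltw (drop j w) (drop i w))
                      (iota 1 (size w).-1).
have hP : has P (iota 1 (size w).-1).
  case: (@exists_min [seq drop i w | i <- iota 1 (size w).-1]).
    by rewrite -size_eq0 size_map size_iota; lia.
  move=> m /mapP[i hi ->] h; apply/hasP; exists i => //.
  by apply/allP => j hj; apply: h; apply: map_f.
have lt : (find P (iota 1 (size w).-1) < (size w).-1)%N.
  by move: hP; rewrite has_find size_iota.
have := nth_find 0 hP; rewrite nth_iota // add1n => /allP h.
split=> //; first by rewrite /min_suffix -/P; lia.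
by move=> j j0 js; apply: h; rewrite mem_iota; lia.
Qed.

(** The cutting point of the standard factorization is characterized by the
    minimality of the suffix. *)
Lemma min_suffix_cat u v : u != [::] -> v != [::] ->
  (forall a b, u ++ v = a ++ b -> a != [::] -> b != [::] -> ~~ ltw b v) ->
  min_suffix (u ++ v) = size u.
Proof.
move=> un vn h.
have su : (0 < size u)%N by rewrite lt0n size_eq0.
have sv : (0 < size v)%N by rewrite lt0n size_eq0.
have s2 : (1 < size (u ++ v))%N by rewrite size_cat; lia.
have [m0 ms hm] := min_suffixP s2.
set m := min_suffix _ in m0 ms hm *.
have e1 : ~~ ltw v (drop m (u ++ v)).
  have := hm (size u) su; rewrite drop_size_cat //; apply.
  by rewrite size_cat; lia.
have e2 : ~~ ltw (drop m (u ++ v)) v.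
  apply: (h (take m (u ++ v))); rewrite ?cat_take_drop //.
    by rewrite -size_eq0 size_takel; lia.
  by rewrite -size_eq0 size_drop; lia.
have e : drop m (u ++ v) = v.
  apply/eqP; apply/negPn/negP => /ltw_total.
  by rewrite (negbTE e1) (negbTE e2).
by move: (congr1 size e); rewrite size_drop size_cat; move: ms; rewrite size_cat; lia.
Qed.

(** The standard factorization of a Lyndon word: the least proper suffix and
    the corresponding prefix are Lyndon. *)
Lemma lyndon_standard w : lyndon w -> (1 < size w)%N ->
  exists u v, [/\ w = u ++ v, min_suffix w = size u, lyndon u && lyndon v,
     ltw u v & forall a b, w = a ++ b -> a != [::] -> b != [::] -> ~~ ltw b v].
Proof.
move=> hw sw; have [m0 ms hm] := min_suffixP sw.
set m := min_suffix w in m0 ms hm *.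
pose u := take m w; pose v := drop m w.
have ew : w = u ++ v by rewrite cat_take_drop.
have su : size u = m by rewrite size_takel //; lia.
have un : u != [::] by rewrite -size_eq0; lia.
have vn : v != [::] by rewrite -size_eq0 size_drop; lia.
have hmin a b : w = a ++ b -> a != [::] -> b != [::] -> ~~ ltw b v.
  rewrite -!size_eq0 => e an bn; have := hm (size a).
  by rewrite e drop_size_cat // -e; apply; rewrite ?e ?size_cat; lia.
exists u, v; split=> //; first (apply/andP; split).
- apply/lyndonP; split=> // a c e an cn.
  have nc : ~~ ltw (c ++ v) v.
    by apply: (hmin a) => //; [rewrite ew {1}e catA | case: (c) cn].
  have wc : ltw w (c ++ v).
    by rewrite {1}ew e -catA; apply: lyndon_suffix; rewrite ?catA -?e -?ew //; case: (c) cn.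
  have nuc : u != c.
    by apply: contra_neq an => uc; move: (congr1 size e); rewrite uc size_cat; case: (a) => //=; lia.
  case/orP: (ltw_total nuc) => // cu.
  (* A suffix [c < u] that is a prefix of [u] would leave a suffix of [w]
     smaller than [v]. *)
  case: (boolP (prefix c u)) => [/prefixP[d ed]|np].
    have dn : d != [::] by apply: contra_neq nuc => d0; rewrite ed d0 cats0.
    have := hmin c (d ++ v); rewrite catA -ed -ew => /(_ erefl cn).
    have -> : d ++ v != [::] by case: (d) dn.
    move=> /(_ isT) /negP[].
    by move: wc; rewrite ew ed -catA ltw_cat2l.
  by move: (ltw_mismatch v v cu np); rewrite -ew => /ltwNgt; rewrite wc.
- apply/lyndonP; split=> // a b e an bn.
  have nb : ~~ ltw b v.
    apply: (hmin (u ++ a)) => //; first by rewrite ew {1}e catA.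
    by case: (u) un.
  have nvb : v != b.
    by apply: contra_neq an => vb; move: (congr1 size e); rewrite vb size_cat; case: (a) => //=; lia.
  by case/orP: (ltw_total nvb) => //; rewrite (negbTE nb).
by apply: lyndon_lt_suffix; rewrite // -ew.
Qed.

(** The factorization of [u ++ v], for Lyndon words [u < v], is standard when no
    proper suffix of [u] is smaller than [v]. *)
Lemma min_suffix_lyndon_cat u v : lyndon u -> lyndon v -> ltw u v ->
  (forall a b, u = a ++ b -> a != [::] -> b != [::] -> ~~ ltw b v) ->
  min_suffix (u ++ v) = size u.
Proof.
move=> hu hv uv h; have [un vn] := (lyndon_neq0 hu, lyndon_neq0 hv).
apply: min_suffix_cat => // a b e an bn.
case: (ltnP (size a) (size u)) => s.
  have [c eu ->] := eq_cat_split e (ltnW s).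
  have cn : c != [::] by apply: contraTneq s => c0; rewrite eu c0 cats0 ltnn.
  apply: contra (h _ _ eu an cn); apply: ltw_trans.
  by apply: ltw_catr.
have [c ea ev] := eq_cat_split (esym e) s.
case: (eqVneq c [::]) => [c0|cn]; first by rewrite ev c0 ltww.
by apply: ltwNgt; rewrite {1}ev; apply: lyndon_suffix; rewrite -?ev.
Qed.
End Words.

(** * Powers and rotations of words *)

Section Powers.
Variables (T : eqType) (f : T -> nat).
Hypothesis f_inj : injective f.
Implicit Types (a b c u v w : seq T) (x y : T).
Local Notation ltw := (ltw f).
Local Notation lyndon := (lyndon f).

(** The [n]-th power of a word. *)
Definition wpow n w : seq T := flatten (nseq n w).

Lemma wpowS n w : wpow n.+1 w = w ++ wpow n w. Proof. by []. Qed.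

Lemma wpow1 w : wpow 1 w = w. Proof. exact: cats0. Qed.

Lemma wpowD m n w : wpow (m + n) w = wpow m w ++ wpow n w.
Proof. by rewrite /wpow nseqD flatten_cat. Qed.

Lemma wpowSr n w : wpow n.+1 w = wpow n w ++ w.
Proof. by rewrite -addn1 wpowD wpow1. Qed.

Lemma wpowM m n w : wpow m (wpow n w) = wpow (m * n) w.
Proof. by elim: m => // m IH; rewrite wpowS IH mulSn wpowD. Qed.

Lemma size_wpow n w : size (wpow n w) = (n * size w)%N.
Proof. by elim: n => // n IH; rewrite wpowS size_cat IH mulSn. Qed.

Lemma wpow_eq0 n w : (0 < n)%N -> (wpow n w == [::]) = (w == [::]).
Proof. by case: n => // n _; rewrite -!size_eq0 size_wpow muln_eq0. Qed.

Lemma wpow_catC n a b : wpow n (a ++ b) ++ a = a ++ wpow n (b ++ a).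
Proof. by elim: n => [|n IH]; rewrite ?cats0 // !wpowS -!catA IH !catA. Qed.

Lemma rot_wpow r d w : (r <= size w)%N -> rot r (wpow d w) = wpow d (rot r w).
Proof.
case: d => // d h; rewrite -{1}(cat_take_drop r w) wpowS.
rewrite -catA -{1}(size_takel h) rot_size_cat -catA wpow_catC catA -wpowS.
by rewrite /rot.
Qed.

Lemma rot_wpow_lt k d w : w != [::] -> (k <= size (wpow d w))%N ->
  exists2 r, (r < size w)%N & rot k (wpow d w) = rot r (wpow d w).
Proof.
rewrite -size_eq0 => w0; have [n] := ubnP k; elim: n k => // n IH k lkn hk.
case: (ltnP k (size w)) => h; first by exists k.
have [||r hr e] := IH (k - size w)%N; try lia.
exists r => //; rewrite -{1}(subnK h) rotD ?subnK // -e; congr rot.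
by rewrite rot_wpow // rot_size.
Qed.

(** A Lyndon word has no proper nonempty border, as it is smaller than its
    suffixes and larger than its prefixes. *)
Lemma lyndon_unbordered w a b c :
  lyndon w -> w = a ++ b -> w = c ++ a -> a != [::] -> c != [::] -> False.
Proof.
move=> hw e1 e2 an cn.
have h : ltw w a by rewrite {1}e2; apply: lyndon_suffix; rewrite -?e2.
case: (eqVneq b [::]) => [b0|bn]; first by rewrite e1 b0 cats0 ltww in h.
by move: (ltwNgt (ltw_catr f a bn)); rewrite -e1 h.
Qed.

(** A word is the power of at most one Lyndon word: if [u] is shorter than [v],
    the periodicity of the common power makes a border of [v]. *)
Lemma lyndon_wpow_inj u v d e : lyndon u -> lyndon v ->
  (0 < d)%N -> (0 < e)%N -> wpow d u = wpow e v -> u = v /\ d = e.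
Proof.
wlog s : u v d e / (size u <= size v)%N => [H|] hu hv d0 e0 E.
  case: (leqP (size u) (size v)) => h; first exact: H.
  by have [-> ->] := H v u e d (ltnW h) hv hu e0 d0 (esym E).
have un := lyndon_neq0 hu.
have us : (0 < size u)%N by rewrite lt0n size_eq0.
move: s; rewrite leq_eqVlt => /orP[/eqP s|s]; last first.
  case: d d0 E => // d _; case: e e0 => // e _ E.
  have [c ev ed] : exists2 c, v = u ++ c & wpow d u = c ++ wpow e v.
    by apply: (eq_cat_split (esym E)); apply: ltnW.
  have cn : c != [::] by apply: contraTneq s => c0; rewrite ev c0 cats0 ltnn.
  have E2 : v ++ wpow e v = c ++ (wpow e v ++ u) by rewrite -wpowS -E wpowSr ed catA.
  have [|b eb _] := eq_cat_split E2; first by rewrite ev size_cat leq_addl.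
  by case: (lyndon_unbordered hv eb ev cn un).
have uv : u = v.
  case: d d0 E => // d _; case: e e0 => // e _.
  by move=> /(congr1 (take (size u))); rewrite !wpowS take_size_cat // s take_size_cat.
split=> //; move: (congr1 size E); rewrite !size_wpow uv => /eqP.
by rewrite eqn_pmul2r -?uv // => /eqP.
Qed.

(** Commuting words are powers of a common word. *)
Lemma cat_comm a b : a != [::] -> b != [::] -> a ++ b = b ++ a ->
  exists z i j, [/\ (0 < i)%N, (0 < j)%N, a = wpow i z & b = wpow j z].
Proof.
have [n] := ubnP (size a + size b); elim: n a b => // n IH a b.
wlog s : a b / (size a <= size b)%N => [H|] ln an bn e.
  case: (leqP (size a) (size b)) => h; first exact: H.
  have [|z [i [j [i0 j0 ea eb]]]] := H b a (ltnW h) _ bn an (esym e).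
    by rewrite addnC.
  by exists z, j, i.
have [c eb ec] := eq_cat_split (esym e) s.
case: (eqVneq c [::]) => [c0|cn].
  by exists a, 1%N, 1%N; rewrite eb c0 cats0 wpow1.
have sa : (0 < size a)%N by rewrite lt0n size_eq0.
have [||z [i [j [i0 j0 ea ec']]]] := IH a c _ an cn.
- by rewrite eb size_cat in ln; lia.
- by rewrite -eb ec.
- by exists z, i, (i + j)%N; rewrite addn_gt0 i0 eb wpowD -ea -ec'.
Qed.

(** [w] is least among its rotations. *)
Definition minrot w := forall a b, w = a ++ b -> ~~ ltw (b ++ a) w.

(** A word that is least among its rotations is a power of a Lyndon word: if it
    is not Lyndon, it is a product of two commuting nonempty words, hence a
    proper power. *)
Lemma minrot_lyndon m : m != [::] -> minrot m ->
  exists l d, [/\ lyndon l, (0 < d)%N & m = wpow d l].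
Proof.
have [n] := ubnP (size m); elim: n m => // n IH m ln mn hm.
case: (boolP (lyndon m)) => [hl|]; first by exists m, 1%N; rewrite wpow1.
rewrite /lyndon mn /= -has_predC => /hasP[k]; rewrite mem_iota => hk /= nlt.
pose a := take k m; pose b := drop k m.
have em : m = a ++ b by rewrite cat_take_drop.
have sa : size a = k by rewrite size_takel; lia.
have an : a != [::] by rewrite -size_eq0; lia.
have bn : b != [::] by rewrite -size_eq0 size_drop; lia.
have nbm : b != m by apply/eqP => /(congr1 size); rewrite size_drop; lia.
have bm : ltw b m by case/orP: (ltw_total f_inj nbm) => // h; rewrite h in nlt.
have [c ec] : exists c, m = b ++ c.
  apply/prefixP/negPn/negP => np; move: (hm _ _ em).
  by have := ltw_mismatch a [::] bm np; rewrite cats0 => ->.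
have sac : size a = size c by move: (congr1 size ec); rewrite {1}em !size_cat; lia.
have ac : a = c.
  apply/eqP/negPn/negP => /(ltw_total f_inj) /orP[] h.
    by move: (hm _ _ em); rewrite ec ltw_cat2l h.
  move: (hm _ _ ec); rewrite {1}em.
  by rewrite (ltw_size_cat b b (esym sac) h).
have [z [i [j [i0 j0 ea eb]]]] : exists z i j,
    [/\ (0 < i)%N, (0 < j)%N, a = wpow i z & b = wpow j z].
  by apply: cat_comm; rewrite // -em ec ac.
have emz : m = wpow (i + j) z by rewrite wpowD -ea -eb.
have zn : z != [::] by rewrite ea wpow_eq0 in an.
have sz : (0 < size z)%N by rewrite lt0n size_eq0.
have [|||l [d [hl d0 ez]]] := IH z => //.
- by move: ln; rewrite emz size_wpow; nia.
- move=> u v ez; apply/negP => h.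
  have sr : (size u <= size z)%N by rewrite ez size_cat leq_addr.
  have er : rot (size u) m = wpow (i + j) (v ++ u).
    by rewrite emz rot_wpow // ez rot_size_cat.
  move: (hm (take (size u) m) (drop (size u) m)); rewrite cat_take_drop => /(_ erefl).
  rewrite -[_ ++ _]/(rot _ _) er {1}emz; case: (i + j)%N (addn_gt0 i j) => [|k'].
    by rewrite i0.
  move=> _; rewrite !wpowS ltw_size_cat // ez !size_cat addnC //.
- by exists l, ((i + j) * d)%N; rewrite emz ez wpowM muln_gt0 addn_gt0 i0.
Qed.

Lemma rot_rot_ex m n w : exists2 k, (k <= size w)%N & rot m (rot n w) = rot k w.
Proof.
have rle r (s : seq T) : exists2 k, (k <= size s)%N & rot r s = rot k s.
  case: (leqP r (size s)) => h; first by exists r.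
  by exists 0%N; rewrite ?rot0 // rot_oversize // ltnW.
have [n' hn ->] := rle n w; have [m' hm ->] := rle m (rot n' w).
rewrite size_rot in hm.
exists (if (m' + n' <= size w)%N then m' + n' else m' + n' - size w)%N.
  by case: ifP => //; lia.
by rewrite rot_add_mod.
Qed.

Lemma rotr_ex n w : exists2 k, (k <= size w)%N & rotr n w = rot k w.
Proof. by exists (size w - n)%N; rewrite ?leq_subr. Qed.

Lemma lyndon_lt_rot r w : lyndon w -> (0 < r)%N -> (r < size w)%N ->
  ltw w (rot r w).
Proof.
move=> hw r0 rs; have e := cat_take_drop r w.
have an : take r w != [::] by rewrite -size_eq0 size_takel; lia.
have bn : drop r w != [::] by rewrite -size_eq0 size_drop; lia.
rewrite /rot; apply: ltw_trans (ltw_catr _ _ an).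
by rewrite -{1}e; apply: lyndon_suffix; rewrite ?e.
Qed.

Lemma lyndon_minrot l d : lyndon l -> (0 < d)%N -> minrot (wpow d l).
Proof.
move=> hl d0 a b e.
have ln := lyndon_neq0 hl.
have ha : (size a <= size (wpow d l))%N by rewrite e size_cat leq_addr.
have -> : b ++ a = rot (size a) (wpow d l) by rewrite e rot_size_cat.
have [r hr ->] := rot_wpow_lt ln ha; rewrite rot_wpow 1?ltnW //.
case: (posnP r) => [->|r0]; first by rewrite rot0 ltww.
case: d d0 e ha => // d _ _ _; apply: ltwNgt.
by rewrite !wpowS ltw_size_cat ?size_rot // lyndon_lt_rot.
Qed.

(** Every nonempty word is a rotation of a power of a Lyndon word. *)
Lemma necklace_ex w : w != [::] -> exists l d r,
  [/\ lyndon l, (0 < d)%N, (r < size l)%N & w = rot r (wpow d l)].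
Proof.
move=> wn; have sw : (0 < size w)%N by rewrite lt0n size_eq0.
have [|m /mapP[i _ em] h] := @exists_min _ f [seq rot i w | i <- iota 0 (size w).+1].
  by [].
have mn : m != [::] by rewrite -size_eq0 em size_rot size_eq0.
have [|l [d [hl d0 e]]] := minrot_lyndon mn.
  move=> a b e; apply: h.
  have -> : b ++ a = rot (size a) (rot i w) by rewrite -em e rot_size_cat.
  by have [k hk ->] := rot_rot_ex (size a) i w; apply: (map_f (fun i => rot i w)); rewrite mem_iota.
have [k hk ek] := rotr_ex i m.
have [r hr er] := @rot_wpow_lt k d l (lyndon_neq0 hl) ltac:(by rewrite -e).
by exists l, d, r; split=> //; rewrite -er -e -ek em rotK.
Qed.

(** A power of a Lyndon word is least among its rotations, and the rotations of
    a Lyndon word are distinct. *)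
Lemma necklace_inj l d r l' d' r' : lyndon l -> (0 < d)%N -> (r < size l)%N ->
  lyndon l' -> (0 < d')%N -> (r' < size l')%N ->
  rot r (wpow d l) = rot r' (wpow d' l') -> [/\ l = l', d = d' & r = r'].
Proof.
move=> hl d0 hr hl' d0' hr' e.
have not_lt u v k : minrot u -> v = rot k u -> ~~ ltw v u.
  by move=> hu ->; rewrite /rot; apply: hu; rewrite cat_take_drop.
have rot_sym u v i j : rot i u = rot j v -> exists k, v = rot k u.
  move=> e1; have [k1 _ ek1] := rotr_ex j (rot j v).
  have [k2 _ ek2] := rot_rot_ex k1 i u.
  by exists k2; rewrite -ek2 e1 -ek1 rotK.
have E : wpow d l = wpow d' l'.
  apply/eqP/negPn/negP => /(ltw_total f_inj) /orP[] h.
    have [k ek] := rot_sym _ _ _ _ (esym e).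
    by move: (not_lt _ _ _ (lyndon_minrot hl' d0') ek); rewrite h.
  have [k ek] := rot_sym _ _ _ _ e.
  by move: (not_lt _ _ _ (lyndon_minrot hl d0) ek); rewrite h.
have [el ed] := lyndon_wpow_inj hl hl' d0 d0' E; subst l' d'; split=> //.
have {}e : rot r l = rot r' l.
  move: e; rewrite !rot_wpow 1?ltnW //; case: (d) d0 => // k _ /(congr1 (take (size l))).
  by rewrite !wpowS !take_size_cat ?size_rot.
have rot_lt s t : (s < t)%N -> (t < size l)%N -> rot s l = rot t l -> False.
  move=> st tl; rewrite -(subnKC (ltnW st)) rotD ?subnKC ?(ltnW st) 1?ltnW // => /rot_inj e1.
  have := @lyndon_lt_rot (t - s) l hl; rewrite -e1 ltww subn_gt0 st => /(_ isT).
  by case: ltnP => //; [move=> _ /(_ isT) | lia].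
case: (ltngtP r r') => // h; first by case: (rot_lt _ _ h hr' e).
by case: (rot_lt _ _ h hr (esym e)).
Qed.
End Powers.

(** * Spans and decompositions into direct sums *)

Section LinearMaps.
Variables (F : fieldType) (L M : lmodType F) (f : L -> M).
Hypothesis lin : linear f.

Lemma lin0 : f 0 = 0.
Proof. by have := lin (-1) 0 0; rewrite scaler0 addr0 scaleN1r addNr. Qed.

Lemma linD x y : f (x + y) = f x + f y.
Proof. by have := lin 1 x y; rewrite !scale1r. Qed.

Lemma linZ a x : f (a *: x) = a *: f x.
Proof. by have := lin a x 0; rewrite lin0 !addr0. Qed.

Lemma linN x : f (- x) = - f x.
Proof. by rewrite -scaleN1r linZ scaleN1r. Qed.

Lemma lin_sum (I : Type) (r : seq I) (P : pred I) (E : I -> L) :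
  f (\sum_(i <- r | P i) E i) = \sum_(i <- r | P i) f (E i).
Proof. exact: (big_morph f linD lin0). Qed.

End LinearMaps.

Section Spans.
Variables (F : fieldType) (L : lmodType F).
Implicit Types (V B : set L).

Lemma subspaceD V x y : subspace V -> V x -> V y -> V (x + y).
Proof. by case=> _ h /(h 1 x y); rewrite scale1r; apply. Qed.

Lemma subspaceZ V a x : subspace V -> V x -> V (a *: x).
Proof. by case=> h0 h hx; rewrite -[_ *: _]addr0; apply: h. Qed.

Lemma subspaceN V x : subspace V -> V x -> V (- x).
Proof. by move=> hV hx; rewrite -scaleN1r; apply: subspaceZ. Qed.

Lemma subspace_sum V (I : Type) (r : seq I) (P : pred I) (E : I -> L) :
  subspace V -> (forall i, P i -> V (E i)) -> V (\sum_(i <- r | P i) E i).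
Proof.
move=> hV h; elim/big_ind: _ => //; first by case: hV.
by move=> x y; apply: subspaceD.
Qed.

(** The linear span of [B], as the intersection of the subspaces that
    contain it. *)
Definition lspan B : set L :=
  [set x | forall V, subspace V -> B `<=` V -> V x].

Lemma lspan_subspace B : subspace (lspan B).
Proof.
split=> [V [V0 _] _|a x y hx hy V hV BV]; first exact: V0.
by case: (hV) => _; apply; [apply: hx | apply: hy].
Qed.

Lemma sub_lspan B : B `<=` lspan B.
Proof. by move=> x Bx V _; apply. Qed.

Lemma lspan_sub B V : subspace V -> B `<=` V -> lspan B `<=` V.
Proof. by move=> hV BV x; apply. Qed.

Lemma lspanS B B' : B `<=` B' -> lspan B `<=` lspan B'.
Proof.
by move=> h; apply: lspan_sub (lspan_subspace _) _ => x /h; apply: sub_lspan.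
Qed.

Lemma preim_subspace (M : lmodType F) (f : M -> L) V :
  linear f -> subspace V -> subspace [set x | V (f x)].
Proof.
move=> lf [V0 hV]; split=> /= [|a x y hx hy]; first by rewrite (lin0 lf).
by rewrite lf; apply: hV.
Qed.
End Spans.

Lemma lspan_map (F : fieldType) (L M : lmodType F) (f : L -> M) (B : set L)
    (V : set M) : linear f -> subspace V -> (forall x, B x -> V (f x)) ->
  forall x, lspan B x -> V (f x).
Proof. by move=> lf hV h; apply: lspan_sub h; apply: preim_subspace. Qed.

(** A family of linear projections onto the summands of a decomposition. *)
Definition projections (F : fieldType) (L : lmodType F) (I : choiceType)
    (C : I -> set L) (pr : I -> L -> L) : Prop :=
  [/\ forall i, linear (pr i),
      forall i x, C i (pr i x),
      forall i x, C i x -> pr i x = x,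
      forall i j x, i != j -> C j x -> pr i x = 0
    & forall x, exists2 s : {fset I}, (forall i, i \notin s -> pr i x = 0)
        & x = \sum_(i <- s) pr i x].

Section Decompositions.
Variables (F : fieldType) (L : lmodType F) (I : choiceType) (C : I -> set L).

(** A sum of finite support is a sum over a finite set of indices. *)
Lemma finite_support_fset (f : I -> L) : finite_set [set i | f i != 0] ->
  exists2 s : {fset I}, (forall i, i \notin s -> f i = 0)
    & \sum_(i \in [set: I]) f i = \sum_(i <- s) f i.
Proof.
move=> ff; pose s := fset_set [set i | f i != 0].
have hs i : i \notin s -> f i = 0.
  by apply: contraNeq => h; rewrite /s in_fset_set // inE.
by exists s => //; rewrite (@fsbigTE _ _ _ _ s).
Qed.

Lemma projections_direct pr : (forall i, subspace (C i)) ->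
  projections C pr -> direct_decomposition C.
Proof.
move=> hC [lp pC pid p0 ps]; split=> // x.
have [s hs ex] := ps x.
exists (fun i => pr i x); split; first split=> //.
- apply: (sub_finite_set _ (finite_fset s)) => i /=; apply: contraNP.
  by move=> /negP/hs ->; rewrite eqxx.
- by rewrite (@fsbigTE _ _ _ _ s).
move=> f [fC ff ef]; apply/funext => i.
have [t ht et] := finite_support_fset ff; rewrite ef et (lin_sum (lp i)).
transitivity (\sum_(j <- t) if j == i then f i else 0).
  apply: eq_bigr => j _; case: eqVneq => [->|ji]; first exact: pid.
  by apply: p0 (fC j); rewrite eq_sym.
rewrite -big_mkcond /= -big_filter; case: (boolP (i \in t)) => it.
  rewrite (perm_big [:: i]) ?big_seq1 //; apply: uniq_perm => //.
    by apply: filter_uniq; apply: fset_uniq.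
  by move=> j; rewrite mem_filter inE andbC; case: eqVneq => [->|]; rewrite ?andbF ?it.
by rewrite ht // big1.
Qed.

Lemma direct_projections :
  direct_decomposition C -> exists pr, projections C pr.
Proof.
case=> hC hex.
have [dec hdec] := choice hex.
have uniq_dec x f : (forall i, C i (f i)) -> finite_set [set i | f i != 0] ->
    x = \sum_(i \in [set: I]) f i -> dec x = f.
  by move=> h1 h2 h3; have [_] := hdec x; apply.
have uniq_fset x f (s : {fset I}) : (forall i, C i (f i)) ->
    (forall i, i \notin s -> f i = 0) -> x = \sum_(i <- s) f i -> dec x = f.
  move=> h1 h2 h3; apply: uniq_dec => //; last by rewrite (@fsbigTE _ _ _ _ s).
  apply: (sub_finite_set _ (finite_fset s)) => i /=; apply: contraNP.
  by move=> /negP/h2 ->; rewrite eqxx.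
have ex_fset x : exists2 s : {fset I}, (forall i, i \notin s -> dec x i = 0)
        & x = \sum_(i <- s) dec x i.
  have [[_ h2 h3] _] := hdec x; have [s hs es] := finite_support_fset h2.
  by exists s; rewrite // -es.
have single j x : C j x -> dec x = fun i => if i == j then x else 0.
  move=> hx; apply: (uniq_fset _ _ [fset j]%fset).
  - by move=> i; case: eqVneq => [->//|_]; case: (hC i).
  - by move=> i; rewrite inE => /negbTE ->.
  - by rewrite big_seq_fset1 eqxx.
exists (fun i x => dec x i); split.
- move=> i a x y; have [s hs es] := ex_fset x; have [t ht et] := ex_fset y.
  suff -> : dec (a *: x + y) = fun i => a *: dec x i + dec y i by [].
  apply: (uniq_fset _ _ (s `|` t)%fset).
  - move=> j; case: (hC j) => _; apply.
      by have [[+ _ _] _] := hdec x; apply.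
    by have [[+ _ _] _] := hdec y; apply.
  - move=> j; rewrite inE negb_or => /andP[/hs -> /ht ->].
    by rewrite scaler0 addr0.
  have wid (f : I -> L) (u v : {fset I}) : (forall j, j \notin u -> f j = 0) ->
     \sum_(j <- (u `|` v)%fset) f j = \sum_(j <- u) f j.
    move=> hu; rewrite -(@fsbigTE _ _ _ _ (u `|` v)%fset) ?(@fsbigTE _ _ _ _ u) //.
    by move=> j; rewrite inE negb_or => /andP[/hu].
  rewrite big_split /= -scaler_sumr (wid (dec x)) // fsetUC (wid (dec y)) //.
  by rewrite -es -et.
- by move=> i x; have [[h _ _] _] := hdec x.
- by move=> i x /single ->; rewrite eqxx.
- by move=> i j x ij /single ->; rewrite (negbTE ij).
- exact: ex_fset.
Qed.

End Decompositions.

Lemma projections_lspan (F : fieldType) (L : lmodType F) (I : choiceType)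
    (C : I -> set L) pr (B : set L) i :
  projections C pr -> (forall x, B x -> exists j, C j x) ->
  forall x, lspan B x -> lspan (B `&` C i) (pr i x).
Proof.
case=> lp pC pid p0 _ hB; apply: lspan_map => //; first exact: lspan_subspace.
move=> x Bx; have [j Cj] := hB x Bx; case: (eqVneq i j) => [ij|ij].
  by subst j; rewrite pid //; apply: sub_lspan.
by rewrite (p0 i j) //; case: (lspan_subspace (B `&` C i)).
Qed.

(** * Iterated commutators in characteristic [p] *)

Section PrimeCharacteristic.
Variables (p : nat) (R : nzRingType).
Hypotheses (p_pr : prime p) (pR : p%:R = 0 :> R).

Lemma bin_char k : (0 < k < p)%N -> ('C(p, k))%:R = 0 :> R.
Proof.
by move=> /(prime_dvd_bin p_pr)/dvdnP[q ->]; rewrite natrM pR mulr0.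
Qed.

Lemma signr_char : (-1) ^+ p = -1 :> R.
Proof.
case: (even_prime p_pr) => [p2|o]; last by rewrite -signr_odd o expr1.
by rewrite p2 sqrrN expr1n; apply/eqP; rewrite -subr_eq0 opprK -mulr2n -{1}p2 pR.
Qed.

(** The signed binomial coefficients of order [p - 1] are all 1. *)
Lemma bin_pred_char k : (k < p)%N -> (-1) ^+ k *+ 'C(p.-1, k) = 1 :> R.
Proof.
elim: k => [|k IH] hk; first by rewrite bin0 expr0.
have := @bin_char k.+1; rewrite hk => /(_ isT).
rewrite -[X in 'C(X, _)](prednK (prime_gt0 p_pr)) binS natrD => /eqP.
rewrite addr_eq0 => /eqP h.
by rewrite -mulr_natr h exprS mulN1r mulrNN mulr_natr IH // ltnW.
Qed.

(** The binomial formula for the commuting operators [z |-> x * z] and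
    [z |-> tau z * x]. *)
Lemma iter_twisted_ad (tau : R -> R) (x : R) n z :
  {morph tau : u v / u + v} -> {morph tau : u / - u} -> 
  (forall u, tau (x * u) = x * tau u) -> (forall u, tau (u * x) = tau u * x) ->
  iter n (fun u => x * u - tau u * x) z =
  \sum_(k < n.+1) (x ^+ (n - k) * iter k tau z * x ^+ k) * (-1) ^+ k *+ 'C(n, k).
Proof.
move=> tauD tauN tauxl tauxr.
have taul k u : tau (x ^+ k * u) = x ^+ k * tau u.
  by elim: k => [|k IH]; rewrite ?mul1r // exprS -mulrA tauxl IH mulrA.
have taur k u : tau (u * x ^+ k) = tau u * x ^+ k.
  by elim: k => [|k IH]; rewrite ?mulr1 // exprSr mulrA tauxr IH mulrA.
have tau0 : tau 0 = 0 by apply: (addrI (tau 0)); rewrite -tauD !addr0.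
have tauMn u m : tau (u *+ m) = tau u *+ m.
  by elim: m => [|m IH]; rewrite ?mulr0n // !mulrS tauD IH.
have tauS u k : tau (u * (-1) ^+ k) = tau u * (-1) ^+ k.
  by rewrite -signr_odd; case: odd; rewrite ?mulr1 // expr1 !mulrN1 tauN.
elim: n => [|n IH].
  by rewrite big_ord1 /= !expr0 mul1r !mulr1 bin0.
rewrite iterS IH (big_morph tau tauD tau0) mulr_sumr mulr_suml.
rewrite big_ord_recl [in RHS]big_ord_recl /= !bin0 !mulr1n -addrA; congr (_ + _).
  by rewrite !subn0 !expr0 !mulr1 mulrA -exprS.
under [in RHS]eq_bigr => k _ do rewrite /bump leq0n add1n binS mulrnDr.
rewrite big_split /= [in RHS]big_ord_recr /= bin_small // mulr0n addr0.
congr (_ + _); first apply: eq_bigr => k _.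
  rewrite /bump leq0n add1n mulrnAr !mulrA -exprS; congr (x ^+ _ * _ * _ * _ *+ _).
  by have := ltn_ord k; lia.
rewrite -sumrN; apply: eq_bigr => k _.
rewrite tauMn tauS taur taul subSS mulrnAl -mulNrn; congr (_ *+ _).
rewrite [(-1) ^+ k.+1]exprS mulN1r mulrN; congr (- _).
rewrite [x ^+ k.+1]exprSr -!mulrA; congr (_ * (_ * (_ * _))).
by rewrite -signr_odd; case: odd; rewrite ?mulr1 ?mul1r // expr1 mulrN1 mulN1r.
Qed.

Lemma iter_twisted_ad_char (tau : R -> R) (x : R) z :
  {morph tau : u v / u + v} -> {morph tau : u / - u} -> 
  (forall u, tau (x * u) = x * tau u) -> (forall u, tau (u * x) = tau u * x) ->
  iter p (fun u => x * u - tau u * x) z = x ^+ p * z - iter p tau z * x ^+ p.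
Proof.
move=> h1 h2 h3 h4; rewrite iter_twisted_ad //.
rewrite -(big_mkord xpredT
  (fun k => x ^+ (p - k) * iter k tau z * x ^+ k * (-1) ^+ k *+ 'C(p, k))).
rewrite big_nat_recr //= big_ltn ?prime_gt0 // big_nat big1 ?addr0 => [|k hk].
  by rewrite subn0 subnn bin0 binn signr_char !expr0 !mulr1 mul1r mulrN1.
by rewrite -mulr_natr bin_char ?mulr0.
Qed.

Lemma iter_ad_pred_char (a : R) z :
  iter p.-1 (fun u => a * u - u * a) z =
  \sum_(k < p) a ^+ (p.-1 - k) * z * a ^+ k.
Proof.
rewrite (@iter_twisted_ad id) // prednK ?prime_gt0 //.
apply: eq_bigr => k _; rewrite -mulrnAr bin_pred_char // mulr1.
by rewrite (_ : iter k id z = z) //; elim: (nat_of_ord k).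
Qed.
End PrimeCharacteristic.

(** Jacobson's formula: the coefficients of the noncommutative polynomial
    [(x t + y) ^+ p] in terms of iterated commutators, through the derivative
    with respect to [t]. *)
Section Jacobson.
Variables (p : nat) (R : nzRingType).
Hypotheses (p_pr : prime p) (pR : p%:R = 0 :> R).
Variables x y : R.
Let a : {poly R} := x%:P * 'X + y%:P.

(** The coefficients of a product with [x t + y]. *)
Lemma coef_txyl (q : {poly R}) k :
  (a * q)`_k = (if k is k'.+1 then x * q`_k' else 0) + y * q`_k.
Proof.
rewrite mulrDl -mulrA -commr_polyX mulrA coefD coefMX !coefCM.
by case: k => //= k; rewrite coefCM.
Qed.

Lemma coef_txyr (q : {poly R}) k :
  (q * a)`_k = (if k is k'.+1 then q`_k' * x else 0) + q`_k * y.
Proof.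
rewrite mulrDr mulrA coefD coefMX !coefMC.
by case: k => //= k; rewrite coefMC.
Qed.

Lemma deriv_exp_txy n :
  (a ^+ n)^`() = \sum_(k < n) a ^+ (n.-1 - k) * x%:P * a ^+ k.
Proof.
have da : a^`() = x%:P by rewrite /a derivD derivM !derivC derivX mul0r add0r mulr1 addr0.
elim: n => [|n IH]; first by rewrite expr0 derivC big_ord0.
rewrite exprS derivM da IH mulr_sumr big_ord_recr /= subnn expr0 mul1r addrC.
congr (_ + _); apply: eq_bigr => k _; rewrite !mulrA -exprS; congr (_ ^+ _ * _ * _).
by have := ltn_ord k; lia.
Qed.

Lemma coef_exp_txy_max n : (a ^+ n)`_n = x ^+ n /\ forall k, (n < k)%N -> (a ^+ n)`_k = 0.
Proof.
elim: n => [|n [IH1 IH2]].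
  by split=> [|k]; rewrite expr0 coef1 //; case: k.
rewrite exprS; split=> [|[|k] hk] //; rewrite coef_txyl.
  by rewrite IH1 IH2 // mulr0 addr0 exprS.
by rewrite !IH2 ?mulr0 ?addr0 // ltnW.
Qed.

Lemma coef_exp_txy0 n : (a ^+ n)`_0 = y ^+ n.
Proof. by elim: n => [|n IH]; rewrite ?coef1 // exprS coef_txyl add0r IH exprS. Qed.

Lemma exp_addr_coef n : (x + y) ^+ n = \sum_(k < n.+1) (a ^+ n)`_k.
Proof.
have e1 q : comm_poly q (1 : R) by rewrite /comm_poly mulr1 mul1r.
have hn (q r : {poly R}) : (q * r).[1] = q.[1] * r.[1] by apply: hornerM_comm.
have -> : x + y = a.[1] by rewrite /a hornerD hn !hornerC hornerX mulr1.
have -> : a.[1] ^+ n = (a ^+ n).[1].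
  by elim: n => [|n IH]; rewrite ?hornerC // !exprS hn IH.
rewrite (@horner_coef_wide _ n.+1).
  by apply: eq_bigr => k _; rewrite expr1n mulr1.
by apply/leq_sizeP => k hk; have [_ ->] := coef_exp_txy_max n.
Qed.

Lemma pchar_poly_eq0 : p%:R = 0 :> {poly R}.
Proof. by rewrite -polyC_natr pR. Qed.

Lemma jacobson : (x + y) ^+ p = x ^+ p + y ^+ p + \sum_(1 <= i < p) (a ^+ p)`_i.
Proof.
have p0 := prime_gt0 p_pr.
rewrite exp_addr_coef -(big_mkord xpredT (fun k => (a ^+ p)`_k)) big_ltn // big_nat_recr //=.
have [-> _] := coef_exp_txy_max p.
by rewrite coef_exp_txy0 [X in _ + X]addrC addrA [y ^+ p + _]addrC.
Qed.

Lemma coef_jacobson i : (0 < i)%N -> 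
  (a ^+ p)`_i *+ i = (iter p.-1 (fun u => a * u - u * a) x%:P)`_i.-1.
Proof.
case: i => // i _; rewrite (iter_ad_pred_char p_pr pchar_poly_eq0).
by rewrite -deriv_exp_txy coef_deriv.
Qed.
End Jacobson.

(** * The color Lie [p]-algebra of graded matrices *)

Section Bicharacters.
Variables (F : fieldType) (G : zmodType) (gamma : G -> G -> F).
Hypothesis hgamma : bicharacter gamma.

Lemma gammaDl g g' h : gamma (g + g') h = gamma g h * gamma g' h.
Proof. by case: hgamma. Qed.

Lemma gammaDr g h h' : gamma g (h + h') = gamma g h * gamma g h'.
Proof. by case: hgamma. Qed.

Lemma gammaC g h : gamma g h * gamma h g = 1.
Proof. by case: hgamma. Qed.

Lemma gamma0r g : gamma g 0 = 1.
Proof.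
have n0 : gamma g 0 != 0 by apply: contra_eq_neq (gammaC g 0) => ->; rewrite mul0r eq_sym oner_eq0.
by apply: (mulfI n0); rewrite -gammaDr addr0 mulr1.
Qed.

Lemma gamma0l g : gamma 0 g = 1.
Proof. by have := gammaC 0 g; rewrite gamma0r mulr1. Qed.

Lemma gammaMnr g h n : gamma g (h *+ n) = gamma g h ^+ n.
Proof. by elim: n => [|n IH]; rewrite ?gamma0r // mulrS gammaDr IH exprS. Qed.
End Bicharacters.

(** The square matrices, graded by giving the elementary matrix in position
    [(i, j)] the degree [d j - d i]; the bracket is the color commutator. *)
Section MatrixModel.
Variables (p : nat) (F : fieldType) (G : zmodType) (gamma : G -> G -> F).
Hypotheses (hp : p \in [pchar F]) (hgamma : bicharacter gamma).
Hypothesis hGplus : forall g : G, gamma g g = 1.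
Variables (n : nat) (d : nat -> G).
Notation Mx := 'M[F]_n.+1.
Implicit Types (A B C : Mx) (g h : G).

(** The matrices that are homogeneous of degree [g]. *)
Definition mxcomp g : set Mx := [set A | forall i j : 'I_n.+1, A i j != 0 -> d j - d i = g].

(** The multiplication of the component of degree [h] by [gamma g h]. It is a
    ring automorphism, by means of which the bracket with an element [A] of
    degree [g] reads [A * B - mxtwist g B * A]. *)
Definition mxtwist g A : Mx := \matrix_(i, j) (gamma g (d j - d i) * A i j).

(** The color commutator, given by its entries so that it is bilinear on
    nonhomogeneous matrices too. *)
Definition mxbr A B : Mx := \matrix_(i, j) \sum_k
  (A i k * B k j - gamma (d j - d k) (d k - d i) * B i k * A k j).

(** The component of degree [g] of a matrix. *)
Definition mxproj g A : Mx := \matrix_(i, j) (if d j - d i == g then A i j else 0).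

Lemma mxbrE g A B : mxcomp g A -> mxbr A B = A * B - mxtwist g B * A.
Proof.
move=> hA; apply/matrixP => i j; rewrite !mxE -sumrB; apply: eq_bigr => k _.
rewrite mxE; congr (_ - _); case: (eqVneq (A k j) 0) => [->|/hA ->//].
by rewrite !mulr0.
Qed.

Lemma mxtwistM g A B : mxtwist g (A * B) = mxtwist g A * mxtwist g B.
Proof.
apply/matrixP => i j; rewrite !mxE mulr_sumr; apply: eq_bigr => k _.
rewrite !mxE mulrACA -(gammaDr hgamma); congr (gamma g _ * _).
by rewrite [RHS]addrC addrA subrK.
Qed.

Lemma mxtwistD g A B : mxtwist g (A + B) = mxtwist g A + mxtwist g B.
Proof. by apply/matrixP => i j; rewrite !mxE mulrDr. Qed.

Lemma mxtwistN g A : mxtwist g (- A) = - mxtwist g A.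
Proof. by apply/matrixP => i j; rewrite !mxE mulrN. Qed.

Lemma mxtwist_comp g h A : mxcomp h A -> mxtwist g A = gamma g h *: A.
Proof.
move=> hA; apply/matrixP => i j; rewrite !mxE.
by case: (eqVneq (A i j) 0) => [->|/hA ->//]; rewrite !mulr0.
Qed.

Lemma mxtwistDl g h A : mxtwist (g + h) A = mxtwist g (mxtwist h A).
Proof. by apply/matrixP => i j; rewrite !mxE (gammaDl hgamma) mulrA. Qed.

Lemma mxtwist0 A : mxtwist 0 A = A.
Proof. by apply/matrixP => i j; rewrite !mxE (gamma0l hgamma) mul1r. Qed.

Lemma mxtwist_iter g k A : iter k (mxtwist g) A = mxtwist (g *+ k) A.
Proof. by elim: k => [|k IH]; rewrite ?mxtwist0 //= IH mulrS mxtwistDl. Qed.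

Lemma mxcomp_subspace g : subspace (mxcomp g).
Proof.
split=> [i j|a x y hx hy i j]; first by rewrite mxE eqxx.
rewrite !mxE; case: (eqVneq (x i j) 0) => [->|/hx //].
by rewrite mulr0 add0r; apply: hy.
Qed.

Lemma mxcompM g h A B : mxcomp g A -> mxcomp h B -> mxcomp (g + h) (A * B).
Proof.
move=> hA hB i j; rewrite mxE => nz.
have [k] : exists k, A i k * B k j != 0.
  apply/existsP; apply: contraR nz; rewrite negb_exists => /forallP h0.
  by rewrite big1 // => k _; apply/eqP/negPn.
rewrite mulf_eq0 negb_or => /andP[/hA <- /hB <-].
by rewrite [RHS]addrC addrA subrK.
Qed.

Lemma mxcompX g A k : mxcomp g A -> mxcomp (g *+ k.+1) (A ^+ k.+1).
Proof. by move=> hA; elim: k => // k IH; rewrite mulrS exprS; apply: mxcompM. Qed.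

Lemma mxbr_comp g h A B : mxcomp g A -> mxcomp h B -> mxcomp (g + h) (mxbr A B).
Proof.
move=> hA hB; rewrite (mxbrE _ hA) (mxtwist_comp g hB) -scalerAl.
have hS := mxcomp_subspace (g + h).
apply: (subspaceD hS); first exact: mxcompM.
by rewrite -scaleNr; apply: (subspaceZ _ hS); rewrite addrC; apply: mxcompM.
Qed.

Lemma mx_projections : projections mxcomp mxproj.
Proof.
split.
- by move=> g a A B; apply/matrixP => i j; rewrite !mxE; case: eqP; rewrite ?mulr0 ?addr0.
- by move=> g A i j; rewrite mxE; case: (eqVneq (d j - d i) g) => // _; rewrite eqxx.
- move=> g A hA; apply/matrixP => i j; rewrite !mxE; case: eqVneq => // h.
  by apply/esym/eqP; apply: contraNT h => /hA ->.
- move=> g h A gh hA; apply/matrixP => i j; rewrite !mxE; case: eqVneq => // e.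
  by apply/eqP; apply: contraNT gh => /hA <-; rewrite e.
move=> A; pose s : seq G := [seq d ij.2 - d ij.1 | ij : 'I_n.+1 * 'I_n.+1].
have sP (i j : 'I_n.+1) : d i - d j \in [fset g in s]%fset.
  by rewrite !inE; apply/mapP; exists (j, i); rewrite ?mem_enum.
exists [fset g in s]%fset.
  move=> g gs; apply/matrixP => i j; rewrite !mxE; case: eqVneq => // e.
  by move: gs; rewrite -e sP.
apply/matrixP => i j; rewrite summxE.
rewrite (bigD1_seq (d j - d i)) ?fset_uniq //= mxE eqxx big1 ?addr0 // => g.
by rewrite mxE eq_sym => /negbTE ->.
Qed.

Lemma mx_direct : direct_decomposition mxcomp.
Proof. exact: projections_direct mxcomp_subspace mx_projections. Qed.

Lemma mxbr_linearl B : linear (mxbr^~ B).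
Proof.
move=> a A A'; apply/matrixP => i j; rewrite !mxE mulr_sumr -big_split /=.
apply: eq_bigr => k _; rewrite !mxE; ring.
Qed.

Lemma mxbr_linearr A : linear (mxbr A).
Proof.
move=> a B B'; apply/matrixP => i j; rewrite !mxE mulr_sumr -big_split /=.
apply: eq_bigr => k _; rewrite !mxE; ring.
Qed.

Lemma mxbrE_comp g h A B : mxcomp g A -> mxcomp h B ->
  mxbr A B = A * B - gamma g h *: (B * A).
Proof. by move=> hA hB; rewrite (mxbrE _ hA) (mxtwist_comp g hB) scalerAl. Qed.

Lemma mxbr_skew g h A B : mxcomp g A -> mxcomp h B ->
  mxbr A B = - (gamma g h *: mxbr B A).
Proof.
move=> hA hB; rewrite (mxbrE_comp hA hB) (mxbrE_comp hB hA).
by rewrite scalerBr opprB scalerA (gammaC hgamma) scale1r.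
Qed.

Lemma mxbr_alt g A : mxcomp g A -> mxbr A A = 0.
Proof. by move=> hA; rewrite (mxbrE_comp hA hA) hGplus scale1r subrr. Qed.

Lemma mxbr_jacobi g h A B C : mxcomp g A -> mxcomp h B ->
  mxbr A (mxbr B C) = mxbr (mxbr A B) C + gamma g h *: mxbr B (mxbr A C).
Proof.
move=> hA hB; rewrite (mxbrE _ (mxbr_comp hA hB)) (mxbrE_comp hA hB).
rewrite !(mxbrE _ hA) !(mxbrE _ hB) !mxtwistD !mxtwistN !mxtwistM.
rewrite (mxtwist_comp g hB) (mxtwist_comp h hA) -!mxtwistDl (addrC h g).
set T := mxtwist (g + h) C; set Cg := mxtwist g C; set Ch := mxtwist h C.
rewrite !(mulrBl, mulrBr, scalerBr, scalerN, scalerAl, scalerAr, opprB, opprD, opprK).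
rewrite -!(scalerAl, scalerAr) !scalerA (gammaC hgamma) !scale1r.
rewrite !mulrA [RHS]addrACA !subrKA [LHS]addrACA [RHS]addrACA.
by congr (_ + _); rewrite addrC.
Qed.

Lemma pchar_mx : p%:R = 0 :> Mx.
Proof. by rewrite -scaler_nat (pcharf0 hp) scale0r. Qed.

(** The binomial formula applies to [mxtwist g], which fixes [A] because
    [gamma g g = 1]. *)
Lemma mxexp_ad g A B : mxcomp g A -> mxbr (A ^+ p) B = iter p (mxbr A) B.
Proof.
move=> hA; have p_pr := pcharf_prime hp.
have tA : mxtwist g A = A by rewrite (mxtwist_comp g hA) hGplus scale1r.
have hAp : mxcomp (g *+ p) (A ^+ p).
  by rewrite -(prednK (prime_gt0 p_pr)); apply: mxcompX.
rewrite (mxbrE _ hAp) -mxtwist_iter.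
rewrite -(@iter_twisted_ad_char p _ p_pr pchar_mx (mxtwist g) A B).
- by apply: eq_iter => C; rewrite (mxbrE _ hA).
- exact: mxtwistD.
- exact: mxtwistN.
- by move=> C; rewrite mxtwistM tA.
- by move=> C; rewrite mxtwistM tA.
Qed.

(** The color Lie algebra of graded matrices. *)
Definition mxLie : colorLie gamma := @ColorLie F G gamma Mx mxcomp mxbr
  mx_direct mxbr_linearl mxbr_linearr mxbr_comp mxbr_skew mxbr_jacobi mxbr_alt.

(** Only degrees that are multiples of [g] occur when [A] and [B] have degree
    [g]; on them [gamma g] is trivial, and the color brackets with [A] and [B]
    are ordinary commutators. *)
Lemma mx_ad_txy g A B m k : mxcomp g A -> mxcomp g B ->
  let c := iter m (@ad_txy F G gamma mxLie A B) (fun k => if k == 0%N then A else 0) in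
  let a := A%:P * 'X + B%:P in
  c k = (iter m (fun u => a * u - u * a) A%:P)`_k /\ mxcomp (g *+ m.+1) (c k).
Proof.
move=> hA hB /=; elim: m k => [|m IH] k.
  by rewrite /= coefC; split=> //; case: eqP => // _; case: (mxcomp_subspace (g *+ 1)).
rewrite !iterS coefB coef_txyl coef_txyr.
set c := iter m _ _ in IH *; set q := iter m _ _ in IH *.
have br_c C j : mxcomp g C -> mxbr C (c j) = C * c j - c j * C.
  move=> hC; have [_ hc] := IH j; rewrite (mxbrE_comp hC hc).
  by rewrite (gammaMnr hgamma) hGplus expr1n scale1r.
have comp_c C j : mxcomp g C -> mxcomp (g *+ m.+2) (mxbr C (c j)).
  by move=> hC; have [_ hc] := IH j; rewrite mulrS; apply: mxbr_comp.
rewrite /ad_txy /=; split.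
  rewrite opprD addrACA; case: k => [|k].
    by rewrite br_c // (IH 0%N).1 subrr !add0r.
  by rewrite !br_c // (IH k).1 (IH k.+1).1.
apply: subspaceD (mxcomp_subspace _) _ _; last exact: comp_c.
by case: k => [|k]; [case: (mxcomp_subspace (g *+ m.+2)) | exact: comp_c].
Qed.

Lemma mxexp_add g A B : mxcomp g A -> mxcomp g B ->
  (A + B) ^+ p = A ^+ p + B ^+ p + \sum_(1 <= i < p) @s_ F G gamma mxLie p i A B.
Proof.
move=> hA hB; have p_pr := pcharf_prime hp.
rewrite (jacobson p_pr); congr (_ + _ + _).
rewrite !big_nat; apply: eq_bigr => i /andP[i0 ip].
have i_neq0 : i%:R != 0 :> F by rewrite -(dvdn_pcharf hp) gtnNdvd.
rewrite /s_ (mx_ad_txy _ _ hA hB).1 -(coef_jacobson p_pr pchar_mx) //.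
by rewrite -scaler_nat scalerA mulVf // scale1r.
Qed.

Lemma mxexp_comp g A : mxcomp g A -> mxcomp (g *+ p) (A ^+ p).
Proof. by rewrite -(prednK (prime_gt0 (pcharf_prime hp))); apply: mxcompX. Qed.

Lemma mxexp_scale g (a : F) A : mxcomp g A -> (a *: A) ^+ p = a ^+ p *: A ^+ p.
Proof. by rewrite exprZn. Qed.

(** The color Lie [p]-algebra of graded matrices: the [p]-map is the [p]-th
    power. *)
Definition mxLieP : colorLieP p gamma :=
  @ColorLieP p F G gamma mxLie (fun A : Mx => A ^+ p)
    mxexp_comp mxexp_scale mxexp_ad mxexp_add.
End MatrixModel.

(** * Bracketings of Lyndon words *)

Local Notation comp := Defs.comp.

Section Bracketing.
Variables (F : fieldType) (G : zmodType) (gamma : G -> G -> F).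
Variables (L : colorLie gamma) (X : choiceType) (f : X -> nat).
Hypothesis f_inj : injective f.
Variables (degG : X -> G) (iota : X -> L).
Hypothesis iota_comp : forall x, comp (degG x) (iota x).
Implicit Types (u v w a c M : seq X).
Local Notation ltw := (ltw f).
Local Notation lyndon := (lyndon f).

(** The degree of a word in [G]. *)
Definition gdeg w : G := \sum_(x <- w) degG x.

Lemma gdeg_cat u v : gdeg (u ++ v) = gdeg u + gdeg v.
Proof. exact: big_cat. Qed.

(** The recursion on [k] is effective when [size w <= k]. *)
Fixpoint brk k w : L :=
  if k is k'.+1 then
    match w with
    | [::] => 0
    | [:: x] => iota x
    | _ => let i := min_suffix f w in br (brk k' (take i w)) (brk k' (drop i w))
    end
  else 0.

(** The standard bracketing of a word, split recursively at its least proper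
    suffix. *)
Definition bracketing w : L := brk (size w) w.

Lemma min_suffix_bounds w : (1 < size w)%N -> (0 < min_suffix f w < size w)%N.
Proof. by move=> sw; have [m0 ms _] := @min_suffixP _ f w sw; apply/andP. Qed.

Lemma brk_split k w : (1 < size w)%N -> brk k.+1 w =
  br (brk k (take (min_suffix f w) w)) (brk k (drop (min_suffix f w) w)).
Proof. by case: w => [|x [|y w]]. Qed.

Lemma brk_fuel k w : (size w <= k)%N -> brk k w = bracketing w.
Proof.
rewrite /bracketing; have [n] := ubnP (size w); elim: n w k => // n IH w k hn.
case: (ltnP 1 (size w)) => sw; last first.
  by case: w sw {hn} => [|x [|]] //; case: k.
case: k => [|k] hk; first lia.
have /andP[m0 ms] := min_suffix_bounds sw.
have E : size w = (size w).-1.+1 by lia.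
rewrite [in RHS]E !brk_split //; set m := min_suffix f w in m0 ms *.
have st : (size (take m w) = m)%N by rewrite size_takel // ltnW.
have sd : (size (drop m w) = size w - m)%N by rewrite size_drop.
clearbody m; congr br; rewrite [LHS]IH ?[RHS]IH //; rewrite ?st ?sd; lia.
Qed.

Lemma bracketing1 x : bracketing [:: x] = iota x.
Proof. by []. Qed.

Lemma bracketing_split w : (1 < size w)%N -> let i := min_suffix f w in
  bracketing w = br (bracketing (take i w)) (bracketing (drop i w)).
Proof.
move=> sw; have /andP[m0 ms] := min_suffix_bounds sw.
have <- : brk (size w).-1.+1 w = bracketing w by rewrite brk_fuel //; lia.
by rewrite brk_split // !brk_fuel // ?size_drop ?size_takel; lia.
Qed.

Lemma bracketing_cat u v : u != [::] -> v != [::] ->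
  min_suffix f (u ++ v) = size u ->
  bracketing (u ++ v) = br (bracketing u) (bracketing v).
Proof.
move=> un vn e; rewrite bracketing_split.
  by rewrite e take_size_cat // drop_size_cat.
by case: u un {e} => // x u; case: v vn => // y v; rewrite size_cat /= addnS.
Qed.

Lemma bracketing_comp w : w != [::] -> comp (gdeg w) (bracketing w).
Proof.
have [n] := ubnP (size w); elim: n w => // n IH w.
case: w => // x [|y w] hn _; first by rewrite bracketing1 /gdeg big_seq1.
set W := [:: x, y & w] in hn *.
have /andP[m0 ms] := @min_suffix_bounds W isT.
rewrite bracketing_split // -{1}(cat_take_drop (min_suffix f W) W) gdeg_cat.
have st := size_takel (ltnW ms).
have sd := size_drop (min_suffix f W) W.
have nil_size v : (0 < size v)%N -> v != [::] by case: v.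
by apply: br_comp; apply: IH; try apply: nil_size; rewrite ?sd ?st; lia.
Qed.

(** The number of elements of a list below [u] serves as a measure to induct on
    [u]. *)
Lemma count_ltw_lt (Q : seq (seq X)) u v : u \in Q -> ltw u v ->
  (count (ltw^~ u) Q < count (ltw^~ v) Q)%N.
Proof.
move=> uQ uv; have u1 : (0 < count (pred1 u) Q)%N by rewrite -has_count has_pred1.
have := count_predUI (ltw^~ u) (pred1 u) Q.
rewrite (@eq_count _ (predI _ _) pred0) ?count_pred0; last first.
  by move=> z /=; case: eqVneq => [->|]; rewrite ?ltww ?andbF.
have : (count (predU (ltw^~ u) (pred1 u)) Q <= count (ltw^~ v) Q)%N.
  by apply: sub_count => z /= /orP[/ltw_trans|/eqP->//]; apply.
by move=> le; rewrite addn0 => eU; apply: leq_trans le; rewrite eU -addn1 leq_add2l.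
Qed.

(** The bracketings of the Lyndon words below [v] with the letters of [M]. *)
Definition lyndon_below M v : set L :=
  [set z | exists w, [/\ lyndon w, perm_eq w M, ltw w v & z = bracketing w]].

(** The bracket of the bracketings of two Lyndon words [u < v] is a combination
    of bracketings of Lyndon words below [v]: if [(u, v)] is not the standard
    factorization of [u ++ v], the Jacobi identity applies to the standard
    factorization of [u], and the new brackets involve shorter words or have
    a smaller maximum. *)
Lemma br_bracketing_lt u v : lyndon u -> lyndon v -> ltw u v ->
  lspan (lyndon_below (u ++ v) v) (br (bracketing u) (bracketing v)).
Proof.
have [N] := ubnP (size u + size v); elim: N u v => // N IHN u v sN hu hv uv.
set M := u ++ v.
(* The second words [v'] of the pairs [(u', v')] with the letters of [u ++ v]
   all belong to the finite list [Q]. *)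
pose Q := [seq drop i q | q <- permutations M, i <- seq.iota 0 (size M).+1].
have inQ u' v' : perm_eq (u' ++ v') M -> v' \in Q.
  move=> e; apply/allpairsPdep; exists (u' ++ v'), (size u'); split.
  - by rewrite mem_permutations.
  - rewrite mem_iota add0n leq0n ltnS -(perm_size e) size_cat /=; apply: leq_addr.
  - by rewrite drop_size_cat.
have V_sub v' : subspace (lspan (lyndon_below M v')) by exact: lspan_subspace.
suff inner m u' v' : (count (ltw^~ v') Q < m)%N -> perm_eq (u' ++ v') M ->
    lyndon u' -> lyndon v' -> ltw u' v' ->
    lspan (lyndon_below M v') (br (bracketing u') (bracketing v')).
  by apply: (inner (count (ltw^~ v) Q).+1).
elim: m u' v' => // m IHm {hu hv uv} u' v' hm ep hu hv uv.
have [un vn] := (lyndon_neq0 hu, lyndon_neq0 hv).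
(* The brackets of smaller maximum, in either order. *)
have smaller a c : perm_eq (a ++ c) M -> lyndon a -> lyndon c ->
    ltw a v' -> ltw c v' ->
    lspan (lyndon_below M v') (br (bracketing a) (bracketing c)).
  have lt_case x y : perm_eq (x ++ y) M -> lyndon x -> lyndon y ->
      ltw x y -> ltw y v' ->
      lspan (lyndon_below M v') (br (bracketing x) (bracketing y)).
    move=> e hx hy xy yv.
    have : lspan (lyndon_below M y) (br (bracketing x) (bracketing y)).
      by apply: IHm => //; apply: leq_trans (count_ltw_lt (inQ _ _ e) yv) _.
    apply: lspanS => z [w [hw ew wy ->]]; exists w; split=> //.
    exact: ltw_trans wy yv.
  move=> e ha hc av cv.
  have [ga gc] := (bracketing_comp (lyndon_neq0 ha), bracketing_comp (lyndon_neq0 hc)).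
  case: (eqVneq a c) => [ac|/(ltw_total f_inj)/orP[]]; first 2 last.
  - move=> ca; rewrite (br_skew ga gc); apply: (subspaceN (V_sub v')).
    by apply: (subspaceZ _ (V_sub v')); apply: lt_case => //; rewrite perm_catC.
  - by subst c; rewrite (br_alt ga); case: (V_sub v').
  - by move=> ac; apply: lt_case.
case: (ltnP 1 (size u')) => su; last first.
  have s1 : min_suffix f (u' ++ v') = size u'.
    apply: min_suffix_lyndon_cat => // a b e an bn; move: su; rewrite e size_cat.
    by case: a an {e} => // x a; case: b bn => // y b; rewrite /= addnS.
  apply: sub_lspan; exists (u' ++ v'); rewrite -bracketing_cat //; split=> //.
    exact: lyndon_cat.
  exact: ltw_catl.
have [a [c [eu em /andP[ha hc] ac hmin]]] := lyndon_standard f_inj hu su.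
have [an cn] := (lyndon_neq0 ha, lyndon_neq0 hc).
case: (boolP (ltw c v')) => cv; last first.
  have s1 : min_suffix f (u' ++ v') = size u'.
    apply: min_suffix_lyndon_cat => // x y e xn yn.
    apply: contra (hmin _ _ e xn yn) => yv.
    case: (eqVneq c v') => [->//|/(ltw_total f_inj)]; rewrite (negbTE cv) /=.
    exact: ltw_trans.
  apply: sub_lspan; exists (u' ++ v'); rewrite -bracketing_cat //; split=> //.
    exact: lyndon_cat.
  exact: ltw_catl.
have eb : bracketing u' = br (bracketing a) (bracketing c).
  by rewrite eu bracketing_cat // -eu.
have [ga gc] := (bracketing_comp an, bracketing_comp cn).
have -> : br (bracketing u') (bracketing v') =
    br (bracketing a) (br (bracketing c) (bracketing v')) -
    gamma (gdeg a) (gdeg c) *: br (bracketing c) (br (bracketing a) (bracketing v')).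
  by rewrite (br_jacobi (bracketing v') ga gc) -eb addrK.
have av : ltw a v'.
  by apply: ltw_trans uv; rewrite eu; apply: ltw_catr.
have sM : (size u' + size v' = size M)%N.
  by rewrite -size_cat; apply: perm_size.
have sN1 : (size u' + size v' <= N)%N by rewrite sM size_cat.
have sc : (size c < size u')%N.
  by rewrite eu size_cat -[X in (X < _)%N]add0n ltn_add2r; case: (a) an.
have sa : (size a < size u')%N.
  by rewrite eu size_cat -[X in (X < _)%N]addn0 ltn_add2l; case: (c) cn.
apply: (subspaceD (V_sub v')).
  have ihc : lspan (lyndon_below (c ++ v') v') (br (bracketing c) (bracketing v')).
    by apply: IHN => //; apply: leq_trans sN1; rewrite ltn_add2r.
  apply: (lspan_map (br_linearr (bracketing a)) (V_sub v')) ihc.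
  move=> _ [w [hw ew wv ->]]; apply: smaller => //.
  by rewrite (perm_trans _ ep) // eu -catA perm_cat2l.
apply: (subspaceN (V_sub v')); apply: (subspaceZ _ (V_sub v')).
have iha : lspan (lyndon_below (a ++ v') v') (br (bracketing a) (bracketing v')).
  by apply: IHN => //; apply: leq_trans sN1; rewrite ltn_add2r.
apply: (lspan_map (br_linearr (bracketing c)) (V_sub v')) iha.
move=> _ [w [hw ew wv ->]]; apply: smaller => //.
rewrite (perm_trans _ ep) // eu (perm_trans (perm_cat (perm_refl c) ew)) //.
by rewrite catA perm_cat2r perm_catC.
Qed.

(** The bracketings of the Lyndon words. *)
Definition lyndon_elts : set L :=
  [set z | exists2 w, lyndon w & z = bracketing w].

Lemma br_bracketing u z : lyndon u -> lspan lyndon_elts z ->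
  lspan lyndon_elts (br (bracketing u) z).
Proof.
have hS : subspace (lspan lyndon_elts) by exact: lspan_subspace.
have lt x y : lyndon x -> lyndon y -> ltw x y ->
    lspan lyndon_elts (br (bracketing x) (bracketing y)).
  move=> hx hy /(br_bracketing_lt hx hy); apply: lspanS => _ [w [hw _ _ ->]].
  by exists w.
move=> hu; apply: (lspan_map (br_linearr _) hS) => _ [v hv ->].
have [gu gv] := (bracketing_comp (lyndon_neq0 hu), bracketing_comp (lyndon_neq0 hv)).
case: (eqVneq u v) => [uv|/(ltw_total f_inj)/orP[]]; last 1 first.
- by move=> vu; rewrite (br_skew gu gv); apply: (subspaceN hS); apply: (subspaceZ _ hS); apply: lt.
- by subst v; rewrite (br_alt gu); case: hS.
- exact: lt.
Qed.
End Bracketing.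

(** * Linear independence *)

Section PowerElements.
Variables (p : nat) (F : fieldType) (G : zmodType) (gamma : G -> G -> F).
Variables (L : colorLieP p gamma) (X : choiceType) (f : X -> nat).
Variables (degG : X -> G) (iota : X -> L).
Hypothesis iota_comp : forall x, comp (degG x) (iota x).

(** The iterated [p]-powers of the bracketing of a word. *)
Definition pelt (w : seq X) k : L := iter k (@Defs.pmap _ _ _ _ L) (bracketing f iota w).

Lemma pelt_comp w k : w != [::] -> comp (gdeg degG w *+ p ^ k) (pelt w k).
Proof.
move=> wn; elim: k => [|k IH]; first exact: bracketing_comp.
by rewrite expnSr mulrnA; apply: Defs.pmap_comp.
Qed.
End PowerElements.

Section Independence.
Variables (p : nat) (F : fieldType) (G : zmodType) (gamma : G -> G -> F).
Hypotheses (hp : p \in [pchar F]) (hgamma : bicharacter gamma).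
Hypothesis hGplus : forall g : G, gamma g g = 1.
Variables (X : choiceType) (f : X -> nat).
Hypothesis f_inj : injective f.
Variable degG : X -> G.
Implicit Types (u v w : seq X).
Local Notation ltw := (ltw f).
Local Notation lyndon := (lyndon f).

Section LeadingWords.
Variable W : seq X.
Local Notation n := (size W).
Let d i := gdeg degG (take i W).
Implicit Types A B : 'M[F]_n.+1.

(** The factor of [W] between positions [i] and [j]. *)
Let factor i j := take (j - i) (drop i W).

(** [A] has leading word [u], with coefficient 1: an entry in position
    [(i, j)] is read as the coefficient of the factor of [W] between [i] and
    [j]. *)
Definition leading u A := forall i j : 'I_n.+1,
  (A i j != 0 -> (i + size u)%N = j /\ ~~ ltw (factor i j) u) /\
  ((i <= j)%N -> factor i j = u -> A i j = 1).

Lemma size_factor (i j : 'I_n.+1) : size (factor i j) = (j - i)%N.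
Proof.
rewrite /factor size_take size_drop; have := ltn_ord j; have := ltn_ord i.
by case: ifP; lia.
Qed.

Lemma factor_cat i k j : (i <= k)%N -> (k <= j)%N ->
  factor i j = factor i k ++ factor k j.
Proof.
move=> ik kj; rewrite /factor.
have -> : (j - i = (k - i) + (j - k))%N by lia.
by rewrite takeD drop_drop subnK.
Qed.

Lemma leading_mul u v A B : leading u A -> leading v B ->
  leading (u ++ v) (A * B).
Proof.
move=> hA hB i j; split=> [|ij e].
  rewrite mxE => nz.
  have [k] : exists k, A i k * B k j != 0.
    apply/existsP; apply: contraR nz; rewrite negb_exists => /forallP h0.
    by rewrite big1 // => k _; apply/eqP/negPn.
  rewrite mulf_eq0 negb_or => /andP[/(hA i k).1[ik nu] /(hB k j).1[kj nv]].
  rewrite size_cat; split; first by rewrite addnA ik.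
  have ikle : (i <= k)%N by rewrite -ik leq_addr.
  have kjle : (k <= j)%N by rewrite -kj leq_addr.
  rewrite (factor_cat ikle kjle); have su : size (factor i k) = size u.
    by rewrite size_factor -ik addKn.
  case: (eqVneq (factor i k) u) => [->|/(ltw_total f_inj)]; first by rewrite ltw_cat2l.
  rewrite (negbTE nu) /= => lt; apply: ltwNgt.
  by apply: ltw_size_cat => //; rewrite su.
have sz : (size u + size v = j - i)%N by rewrite -size_cat -e size_factor.
have hk : (i + size u < n.+1)%N by have := ltn_ord j; lia.
pose k := Ordinal hk.
have ek : factor i j = factor i k ++ factor k j by apply: factor_cat => /=; lia.
have [eu ev] : factor i k = u /\ factor k j = v.
  have su : size (factor i k) = size u by rewrite size_factor /= addKn.
  move: e; rewrite ek => /eqP; rewrite eqseq_cat // => /andP[/eqP-> /eqP->].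
  by [].
rewrite mxE (bigD1 k) //= (hA i k).2 ?(hB k j).2 //=; try lia.
rewrite mulr1 big1 ?addr0 // => l lk.
suff -> : A i l = 0 by rewrite mul0r.
apply/eqP; apply: contraNT lk => /(hA i l).1[el _].
by apply/eqP/val_inj; rewrite /= el.
Qed.

(** The leading word of a color commutator. *)
Lemma leading_sub u v A B c : ltw (u ++ v) (v ++ u) ->
  leading (u ++ v) A -> leading (v ++ u) B -> leading (u ++ v) (A - c *: B).
Proof.
move=> uv hA hB i j; rewrite !mxE.
have B0 : B i j != 0 -> (i + size (u ++ v))%N = j /\ ltw (u ++ v) (factor i j).
  move=> /(hB i j).1; rewrite !size_cat [(size v + _)%N]addnC => -[-> nlt]; split=> //.
  case: (eqVneq (factor i j) (v ++ u)) => [->//|/(ltw_total f_inj)].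
  by rewrite (negbTE nlt); apply: ltw_trans.
split=> [|ij e].
  case: (eqVneq (B i j) 0) => [->|/B0[h1 h2] _].
    by rewrite mulr0 subr0; apply: (hA i j).1.
  by split=> //; apply: ltwNgt.
rewrite (hA i j).2 //; case: (eqVneq (B i j) 0) => [->|/B0[_]].
  by rewrite mulr0 subr0.
by rewrite e ltww.
Qed.

Lemma leading_exp u A k : leading u A -> leading (wpow k.+1 u) (A ^+ k.+1).
Proof.
move=> hA; elim: k => [|k IH]; first by rewrite wpow1.
by rewrite exprS wpowS; apply: leading_mul.
Qed.

Let M := mxLieP hp hgamma hGplus n d.

(** The image of a letter: one entry 1 on the upper diagonal for each of its
    occurrences in [W]. *)
Definition letter_mx x : 'M[F]_n.+1 :=
  \matrix_(i, j) ((j == i.+1 :> nat) && (factor i j == [:: x]))%:R.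

Lemma letter_mx_comp x : mxcomp d (degG x) (letter_mx x).
Proof.
move=> i j; rewrite mxE; case: andP => [[/eqP ij /eqP e] _|_]; last by rewrite eqxx.
have -> : d j = d i + degG x.
  rewrite /d; have -> : (j = i + (j - i) :> nat)%N by lia.
  by rewrite takeD [take (j - i) _]e gdeg_cat /gdeg big_seq1.
by rewrite addrC addKr.
Qed.

Lemma letter_mx_leading x : leading [:: x] (letter_mx x).
Proof.
move=> i j; rewrite mxE; split=> [|ij e].
  case: andP => [[/eqP ij /eqP e] _|_]; last by rewrite eqxx.
  by rewrite e ltww addn1 ij.
have := size_factor i j; rewrite e eqxx andbT => /= s1.
by have -> : j == i.+1 :> nat by apply/eqP; lia.
Qed.

Variables (L : colorLieP p gamma) (iota : X -> L) (h : L -> M).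
Hypothesis iota_comp : forall x, comp (degG x) (iota x).
Hypothesis h_hom : is_hom h.
Hypothesis h_iota : forall x, h (iota x) = letter_mx x.
Local Notation bracketing := (bracketing f iota).

Lemma leading_bracketing w : lyndon w -> leading w (h (bracketing w)).
Proof.
have [_ hc hb _] := h_hom.
have [k] := ubnP (size w); elim: k w => // k IH w sw hw.
case: (ltnP 1 (size w)) => s1; last first.
  case: w s1 hw {sw} => [|x [|]] // _ _.
  by rewrite bracketing1 h_iota; apply: letter_mx_leading.
have [u [v [ew em /andP[hu hv] uv _]]] := lyndon_standard f_inj hw s1.
have [un vn] := (lyndon_neq0 hu, lyndon_neq0 hv).
rewrite ew bracketing_cat -?ew // hb.
have cu := hc _ _ (bracketing_comp f iota_comp un).
have cv := hc _ _ (bracketing_comp f iota_comp vn).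
rewrite [br _ _](mxbrE_comp gamma cu cv).
have [su sv] : (size u < k)%N /\ (size v < k)%N.
  move: sw; rewrite ew size_cat; case: (u) un => // x u'; case: (v) vn => // y v' _ _ /=.
  by lia.
have [lu lv] := (IH u su hu, IH v sv hv).
rewrite ew; apply: (leading_sub _ _ (leading_mul lu lv) (leading_mul lv lu)).
apply: ltw_trans (ltw_catl hv un uv) _.
exact: ltw_catr.
Qed.

Lemma leading_pelt w k : lyndon w ->
  leading (wpow (p ^ k) w) (h (pelt f iota w k)).
Proof.
have [_ _ _ hpm] := h_hom => hw; have wn := lyndon_neq0 hw.
have -> : h (pelt f iota w k) = (h (bracketing w) : 'M[F]_n.+1) ^+ (p ^ k).
  elim: k => [|k IH]; first by rewrite expr1.
  by rewrite /= (hpm _ _ (pelt_comp f iota_comp k wn)) IH expnSr exprM.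
rewrite -[(p ^ k)%N]prednK ?expn_gt0 ?prime_gt0 ?(pcharf_prime hp) //.
by apply: leading_exp; apply: leading_bracketing.
Qed.

Lemma leading_coef w k : lyndon w -> let c := h (pelt f iota w k) 0 ord_max in
  (wpow (p ^ k) w = W -> c = 1) /\ (c != 0 -> ~~ ltw W (wpow (p ^ k) w)).
Proof.
move=> hw c; have := leading_pelt k hw 0 ord_max.
rewrite /factor /= drop0 subn0 take_size => -[h1 h2]; split=> [e|/h1[]//].
exact: h2.
Qed.
End LeadingWords.

Variables (L : colorLieP p gamma) (iota : X -> L).
Hypothesis hfree : is_free degG iota.

(** The elements [pelt w k], [w] Lyndon, are linearly independent: they have
    distinct leading words. *)
Lemma pelt_free (s : seq (seq X * nat)) (c : seq X * nat -> F) : uniq s ->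
  {in s, forall i, lyndon i.1} ->
  \sum_(i <- s) c i *: pelt f iota i.1 i.2 = 0 -> {in s, forall i, c i = 0}.
Proof.
case: hfree => iota_comp hex us hs e i is_; apply/eqP/negPn/negP => ci.
pose word (j : seq X * nat) := wpow (p ^ j.2) j.1.
have p_pr := pcharf_prime hp.
have pk k : (0 < p ^ k)%N by rewrite expn_gt0 prime_gt0.
have [|W /mapP[j]] := @exists_min _ f [seq word j | j <- s & c j != 0].
  rewrite -size_eq0 size_map size_eq0 -has_filter.
  by apply/hasP; exists i.
rewrite mem_filter => /andP[cj js] eW Wmin.
have [h [[h_hom h_iota] _]] := 
  hex (mxLieP hp hgamma hGplus (size W) (fun i => gdeg degG (take i W)))
      (letter_mx W) (@letter_mx_comp W).
have [hl _ _ _] := h_hom.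
(* The corner entry of the image for the least word [W] of the support
   isolates the coefficient of [j]. *)
have lead := leading_coef iota_comp h_hom h_iota.
have := congr1 (fun A : 'M[F]_((size W).+1) => A 0 ord_max) (congr1 h e).
rewrite (lin_sum hl) (lin0 hl) summxE mxE (bigD1_seq j) //= big_seq_cond big1.
  rewrite addr0 (linZ hl) mxE ((lead _ j.2 (hs _ js)).1 (esym eW)) mulr1.
  by move/eqP; rewrite (negbTE cj).
move=> l /andP[ls lj]; rewrite (linZ hl) mxE.
case: (eqVneq (c l) 0) => [->|cl]; first by rewrite mul0r.
apply/eqP; rewrite mulf_eq0 (negbTE cl) /=; apply: contraNT lj.
move=> /((lead _ l.2 (hs _ ls)).2) nlt.
have nlt2 : ~~ ltw (word l) W by apply: Wmin; apply: map_f; rewrite mem_filter cl.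
have : word l = word j.
  apply/eqP; rewrite -eW; apply/negPn/negP => /(ltw_total f_inj).
  by rewrite (negbTE nlt) (negbTE nlt2).
case: l j ls js {cj cl eW lead nlt nlt2} => [u a] [v b] ls js.
case/(lyndon_wpow_inj (hs _ ls) (hs _ js) (pk _) (pk _)) => /= -> /eqP.
by rewrite eqn_exp2l ?prime_gt1 // => /eqP ->.
Qed.
End Independence.

(** * Subalgebras and generation *)

Local Notation pmap := Defs.pmap.

Section SubmoduleType.
Variables (F : fieldType) (L : lmodType F).

(** The membership in a subspace, as a boolean predicate. The proof argument lets
    the algebraic structures be inferred. *)
Definition subspace_pred (S : set L) (hS : subspace S) : {pred L} :=
  fun x => `[< S x >].

Lemma subspace_pred_closed (S : set L) (hS : subspace S) :
  submod_closed (subspace_pred hS).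
Proof.
split; first by apply/asboolP; case: hS.
move=> a x y /asboolP hx /asboolP hy; apply/asboolP.
by case: hS => _; apply.
Qed.

HB.instance Definition _ (S : set L) (hS : subspace S) :=
  GRing.isSubmodClosed.Build F L (subspace_pred hS) (subspace_pred_closed hS).

(** A subspace as a vector space of its own. *)
Definition subspace_type (S : set L) (hS : subspace S) := {x | subspace_pred hS x}.

HB.instance Definition _ (S : set L) (hS : subspace S) :=
  Choice.on (subspace_type hS).
HB.instance Definition _ (S : set L) (hS : subspace S) :=
  SubType.on (subspace_type hS).
HB.instance Definition _ (S : set L) (hS : subspace S) :=
  [SubChoice_isSubLmodule of subspace_type hS by <:].
End SubmoduleType.

Section SubLieAlgebra.
Variables (p : nat) (F : fieldType) (G : zmodType) (gamma : G -> G -> F).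
Variables (L : colorLieP p gamma) (S : set L).
Hypothesis S_sub : subspace S.
Hypothesis S_br : forall x y, S x -> S y -> S (br x y).
Hypothesis S_pmap : forall g x, comp g x -> S x -> S (pmap x).
Variable pr : G -> L -> L.
Hypothesis pr_proj : projections (@comp F G gamma L) pr.
Hypothesis S_proj : forall g x, S x -> S (pr g x).

Local Notation T := (subspace_type S_sub).
Implicit Types x y z : T.

Lemma valS x : S (val x).
Proof. exact/asboolP/(valP x). Qed.

(** The elements of [S], as elements of the type of [S]. *)
Definition subS (x : L) (hx : S x) : T := Sub x (introT (asboolP _) hx).

Lemma val_subS (w : L) (hw : S w) : val (subS hw) = w.
Proof. exact: SubK. Qed.

(** The restrictions to [S] of the components, the bracket, the [p]-map (0 where
    it leaves [S], which does not happen on homogeneous elements) and the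
    projections. *)
Definition sub_comp g : set T := [set x | comp g (val x)].
Definition sub_br x y : T := subS (S_br (valS x) (valS y)).
Definition sub_pmap x : T :=
  if pselect (S (pmap (val x))) is left h then subS h else 0.
Definition sub_proj g x : T := subS (S_proj g (valS x)).

Lemma val_lin : linear (val : T -> L).
Proof. by move=> a x y; rewrite linearP. Qed.

Lemma sub_direct : direct_decomposition sub_comp.
Proof.
have [lp pC pid p0 ps] := pr_proj.
apply: (@projections_direct _ _ _ _ sub_proj).
  move=> g; split.
    by change (comp g (val (0 : T))); rewrite (lin0 val_lin); case: (comp_direct L) => /(_ g)[].
  move=> a x y hx hy; change (comp g (val (a *: x + y))); rewrite val_lin.
  by have [_ h] := (comp_direct L).1 g; apply: h.
split.
- by move=> g a x y; apply: val_inj; rewrite val_lin /sub_proj !val_subS val_lin lp.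
- by move=> g x; change (comp g (val (sub_proj g x))); rewrite val_subS.
- by move=> g x hx; apply: val_inj; rewrite val_subS pid.
- by move=> g h x gh hx; apply: val_inj; rewrite val_subS (p0 g h) // (lin0 val_lin).
move=> x; have [s hs es] := ps (val x); exists s.
  by move=> g gs; apply: val_inj; rewrite val_subS hs // (lin0 val_lin).
by apply: val_inj; rewrite (lin_sum val_lin) {1}es; apply: eq_bigr => g _; rewrite val_subS.
Qed.

Lemma val_sub_br x y : val (sub_br x y) = br (val x) (val y).
Proof. exact: val_subS. Qed.

(** [S] as a color Lie algebra. *)
Definition subLie : colorLie gamma.
Proof.
refine (@ColorLie F G gamma T sub_comp sub_br sub_direct _ _ _ _ _ _).
- by move=> y a x x'; apply: val_inj; cbv beta; rewrite val_lin !val_sub_br val_lin br_linearl.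
- by move=> y a x x'; apply: val_inj; cbv beta; rewrite val_lin !val_sub_br val_lin br_linearr.
- move=> g h x y hx hy; change (comp (g + h) (val (sub_br x y))).
  by rewrite val_sub_br; apply: br_comp.
- move=> g h x y hx hy; apply: val_inj.
  by rewrite (linN val_lin) (linZ val_lin) !val_sub_br; apply: br_skew.
- move=> g h x y z hx hy; apply: val_inj.
  by rewrite (linD val_lin) (linZ val_lin) !val_sub_br; apply: br_jacobi.
- by move=> g x hx; apply: val_inj; rewrite val_sub_br (lin0 val_lin); apply: br_alt hx.
Defined.

Lemma val_subLie_br x y : val (@br F G gamma subLie x y : T) = br (val x) (val y).
Proof. exact: val_sub_br. Qed.

Lemma val_sub_pmap g x : comp g (val x) -> val (sub_pmap x) = pmap (val x).
Proof.
move=> hx; rewrite /sub_pmap; case: pselect => [h|[]]; first exact: val_subS.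
by apply: S_pmap hx _; apply: valS.
Qed.

Lemma val_s_ i x y : val (@s_ F G gamma subLie p i x y) = s_ p i (val x) (val y).
Proof.
rewrite /s_ (linZ val_lin); congr (_ *: _).
elim: p.-1 (i.-1) => [|m IH] k; first by rewrite /=; case: eqP; rewrite ?(lin0 val_lin).
rewrite !iterS /ad_txy (linD val_lin) val_subLie_br IH; congr (_ + _).
by case: k => [|k]; rewrite ?(lin0 val_lin) // val_subLie_br IH.
Qed.

(** [S] as a color Lie [p]-algebra. *)
Definition subLieP : colorLieP p gamma.
Proof.
refine (@ColorLieP p F G gamma subLie sub_pmap _ _ _ _).
- by move=> g x hx; rewrite /comp /= /sub_comp /= (val_sub_pmap hx); apply: pmap_comp.
- move=> g a x hx; apply: val_inj; rewrite (linZ val_lin) (val_sub_pmap hx).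
  rewrite (@val_sub_pmap g) ?(linZ val_lin) ?(pmap_scale _ hx) //.
  case: (comp_direct L) => /(_ g) h _.
  by apply: subspaceZ.
- move=> g x z hx; apply: val_inj; rewrite val_subLie_br (val_sub_pmap hx) (pmap_ad _ hx).
  have iterE m : val (iter m (@br F G gamma subLie x) z : T) =
      iter m (br (val x)) (val z) by elim: m => // m IH; rewrite !iterS val_subLie_br IH.
  by rewrite iterE.
- move=> g x y hx hy; apply: val_inj.
  rewrite (@val_sub_pmap g) ?(linD val_lin) ?(val_sub_pmap hx) ?(val_sub_pmap hy) ?(lin_sum val_lin).
    by rewrite (pmap_add hx hy); congr (_ + _); apply: eq_bigr => i _; rewrite val_s_.
  case: (comp_direct L) => /(_ g) h _.
  by apply: subspaceD.
Defined.

Lemma val_is_hom : @is_hom p F G gamma subLieP L val.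
Proof.
split=> // g x hx; exact: (@val_sub_pmap g).
Qed.
End SubLieAlgebra.

(** A subalgebra of a free color Lie [p]-algebra that contains the generators
    is everything, by the uniqueness of the morphisms. *)
Lemma free_generated (p : nat) (F : fieldType) (G : zmodType)
    (gamma : G -> G -> F) (X : choiceType) (degG : X -> G)
    (L : colorLieP p gamma) (iota : X -> L) (S : set L) pr :
  is_free degG iota -> subspace S ->
  (forall x y, S x -> S y -> S (br x y)) ->
  (forall g x, comp g x -> S x -> S (pmap x)) ->
  projections (@comp F G gamma L) pr -> (forall g x, S x -> S (pr g x)) ->
  (forall x, S (iota x)) -> forall z, S z.
Proof.
case=> iota_comp hex S_sub S_br S_pmap pr_proj S_proj S_iota z.
pose Ls := subLieP S_sub S_br S_pmap pr_proj S_proj.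
have [h [[h_hom h_iota] _]] := hex Ls (fun x => subS S_sub (S_iota x)) iota_comp.
have [u [_ u_uniq]] := hex L iota iota_comp.
have hid : u = id by apply: u_uniq; split.
have -> : z = val (h z).
  suff e : u = fun z => val (h z) by rewrite -[LHS]/(id z) -hid e.
  have [hl hc hb hpm] := h_hom.
  have [vl vc vb vpm] := val_is_hom S_sub S_br S_pmap pr_proj S_proj.
  apply: u_uniq; split; last by move=> x; rewrite h_iota.
  split.
  - by move=> a x y; rewrite hl vl.
  - by move=> g x /hc /vc.
  - by move=> x y; rewrite hb vb.
  - by move=> g x hx; rewrite (hpm _ _ hx) (vpm g) //; apply: hc.
exact: valS.
Qed.

(** * The basis of a graded component *)

Section WordDegrees.
Variables (X : choiceType) (Lam : addSemigroupType) (degL : X -> Lam).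
Implicit Types (u v w : seq X) (l m : Lam).

(** [Lam] with a neutral element [None] adjoined. *)
Definition oadd : Monoid.com_law (@None Lam) := oAC (@Algebra.addrA Lam) (@Algebra.addrC Lam).

(** The degree of a word in [Lam]; [None] for the empty word. *)
Definition wdeg w : option Lam := \big[oadd/None]_(x <- w) Some (degL x).

Lemma wdeg_cat u v : wdeg (u ++ v) = oadd (wdeg u) (wdeg v).
Proof. exact: big_cat. Qed.

Lemma wdeg_some w : w != [::] -> exists l, wdeg w = Some l.
Proof.
case: w => // x w _; rewrite /wdeg big_cons.
by case: (\big[_/_]_(_ <- _) _) => [m|]; eexists; reflexivity.
Qed.

Lemma wdeg_neq0 w l : wdeg w = Some l -> w != [::].
Proof. by case: w => //; rewrite /wdeg big_nil. Qed.

Lemma wdeg_wpow n w l : (0 < n)%N -> wdeg w = Some l ->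
  wdeg (wpow n w) = Some (pmuln n l).
Proof.
case: n => // n _ e; rewrite /pmuln /=.
by elim: n => [|n IH]; rewrite ?wpow1 // wpowS wdeg_cat e IH.
Qed.

Lemma perm_wdeg u v : perm_eq u v -> wdeg u = wdeg v.
Proof. by move=> h; apply: perm_big. Qed.

End WordDegrees.

Section Dimension.
Variables (F : fieldType) (L : lmodType F).

Lemma has_dim_le (V : set L) m n : has_dim V m -> has_dim V n -> (n <= m)%N.
Proof.
move=> [b [hb eb]] [b' [hb' eb']].
have coefs k (c : 'I_k -> L) j (d : 'I_j -> L) : is_basis V c -> is_basis V d ->
    exists A : 'M[F]_(j, k), forall i, d i = \sum_(l < k) A i l *: c l.
  move=> [hc ec] [hd _].
  have /choice[A hA] : forall i, exists r : 'rV[F]_k, d i = \sum_(l < k) r 0 l *: c l.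
    by move=> i; have [r [hr _]] := ec _ (hd i); exists r.
  exists (\matrix_(i, l) A i 0 l) => i; rewrite hA.
  by apply: eq_bigr => l _; rewrite mxE.
have [A hA] := coefs _ _ _ _ (conj hb eb) (conj hb' eb').
have [B hB] := coefs _ _ _ _ (conj hb' eb') (conj hb eb).
have AB : A *m B = 1%:M.
  apply/row_matrixP => i; have [r [_ ur]] := eb' _ (hb' i).
  transitivity r; [symmetry|]; apply: ur.
    rewrite {1}hA; under eq_bigr => l _ do rewrite hB scaler_sumr.
    rewrite exchange_big /=; apply: eq_bigr => l _; rewrite !mxE scaler_suml.
    by apply: eq_bigr => k _; rewrite scalerA.
  rewrite (bigD1 i) //= !mxE eqxx scale1r big1 ?addr0 // => l li.
  by rewrite !mxE eq_sym (negbTE li) scale0r.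
exact: mulmx1_min AB.
Qed.

Lemma has_dimE (V : set L) n : has_dim V n -> Defs.dim V = n.
Proof.
move=> h; apply/eqP; rewrite /Defs.dim eqn_leq.
have h' : has_dim V (xget 0%N [set n | has_dim V n]) by exact: (xgetPex 0%N (ex_intro _ n h)).
by rewrite (has_dim_le h h') (has_dim_le h' h).
Qed.
End Dimension.

Section FreeBasis.
Variables (p : nat) (F : fieldType) (G : zmodType) (gamma : G -> G -> F).
Hypotheses (hp : p \in [pchar F]) (hgamma : bicharacter gamma).
Hypothesis hGplus : forall g : G, gamma g g = 1.
Variables (X : choiceType) (f : X -> nat).
Hypothesis f_inj : injective f.
Variables (degG : X -> G) (L : colorLieP p gamma) (iota : X -> L).
Hypothesis hfree : is_free degG iota.
Implicit Types (u v w : seq X).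
Local Notation lyndon := (lyndon f).
Local Notation bracketing := (bracketing f iota).
Local Notation pelt := (pelt f iota).

Let iota_comp : forall x, comp (degG x) (iota x) := hfree.1.
Let p_gt0 k : (0 < p ^ k)%N.
Proof. by rewrite expn_gt0 prime_gt0 ?(pcharf_prime hp). Qed.

(** The elements of the basis. *)
Definition pelts : set L := [set z | exists2 i : seq X * nat, lyndon i.1 & z = pelt i.1 i.2].

Local Notation S0 := (lspan (lyndon_elts f iota)).
Local Notation S := (lspan pelts).

Let S0_sub : subspace S0. Proof. exact: lspan_subspace. Qed.
Let S_sub : subspace S. Proof. exact: lspan_subspace. Qed.

Let S0_S z : S0 z -> S z.
Proof. by apply: lspanS => _ [w hw ->]; exists (w, 0%N). Qed.

Lemma iter_mul (T : Type) (g : T -> T) m n z :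
  iter (m * n) g z = iter m (iter n g) z.
Proof. by elim: m => // m IH; rewrite mulSn iterD IH. Qed.

Lemma br_pelt w k z : lyndon w -> br (pelt w k) z = iter (p ^ k) (br (bracketing w)) z.
Proof.
move=> /lyndon_neq0 wn; elim: k z => [|k IH] z //.
rewrite [pelt w k.+1]/= (pmap_ad z (pelt_comp f iota_comp k wn)) expnS.
by rewrite iter_mul; apply: eq_iter => y; apply: IH.
Qed.

(** The span of the elements [pelt w k], [w] Lyndon, is closed under the
    bracket: a bracket with [pelt w k] is an iterated bracket with
    [bracketing w]. *)
Lemma br_pelts x z : S x -> S z -> S (br x z).
Proof.
have iter_S0 w k y : lyndon w -> S0 y -> S0 (iter k (br (bracketing w)) y).
  by move=> hw hy; elim: k => //= k; apply: br_bracketing.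
have br_S0 w y : lyndon w -> S y -> S0 (br (bracketing w) y).
  move=> hw; apply: (lspan_map (br_linearr _) S0_sub) => _ [[v k] /= hv ->].
  have gw := bracketing_comp f iota_comp (lyndon_neq0 hw).
  have gv := pelt_comp f iota_comp k (lyndon_neq0 hv).
  rewrite (br_skew gw gv); apply: (subspaceN S0_sub); apply: (subspaceZ _ S0_sub).
  by rewrite br_pelt //; apply: iter_S0 => //; apply: sub_lspan; exists w.
move=> hx hz; apply: S0_S.
apply: (lspan_map (br_linearl z) S0_sub) hx => _ [[w k] /= hw ->].
rewrite br_pelt // -(prednK (p_gt0 k)) iterSr.
by apply: iter_S0 => //; apply: br_S0.
Qed.

Let pr_ex := direct_projections (comp_direct L).

(** An element of the span that is homogeneous of degree [g] is a combination of
    basis elements of degree [g], on which the [p]-map is additive up to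
    brackets. *)
Lemma pmap_pelts g x : comp g x -> S x -> S (pmap x).
Proof.
have [pr hpr] := pr_ex => gx Sx.
have {Sx} : lspan (pelts `&` comp g) (pr g x).
  apply: (projections_lspan hpr) Sx => _ [[w k] /= hw ->].
  by eexists; apply: (pelt_comp f iota_comp k (lyndon_neq0 hw)).
have [_ _ -> // _ _] := hpr.
have g_sub : subspace (@comp F G gamma L g) by have [h _] := comp_direct L; apply: h.
pose T := [set y | [/\ comp g y, S y & S (pmap y)]].
suff : lspan (pelts `&` comp g) `<=` T by move=> h /h[].
apply: lspan_sub; last first.
  move=> _ [[[w k] /= hw ->] gw]; split=> //; first by apply: sub_lspan; exists (w, k).
  by apply: sub_lspan; exists (w, k.+1).
split.
  split; [by case: g_sub | by case: S_sub |].
  have -> : pmap (0 : L) = 0; last by case: S_sub.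
  have g0 : comp g (0 : L) by case: g_sub.
  rewrite -{1}(scale0r 0) (pmap_scale 0 g0) expr0n.
  by rewrite gtn_eqF ?scale0r // prime_gt0 // (pcharf_prime hp).
move=> a y z [gy Sy Spy] [gz Sz Spz].
have gay : comp g (a *: y) by apply: (subspaceZ _ g_sub).
have Say : S (a *: y) by apply: (subspaceZ _ S_sub).
split; [exact: (subspaceD g_sub) | exact: (subspaceD S_sub) |].
rewrite (pmap_add gay gz); apply: (subspaceD S_sub).
  apply: (subspaceD S_sub) => //.
  by rewrite (pmap_scale a gy); apply: (subspaceZ _ S_sub).
apply: (subspace_sum _ S_sub) => i _; apply: (subspaceZ _ S_sub).
elim: p.-1 (i.-1) => [|m IH] k /=.
  by case: eqP => // _; case: S_sub.
apply: (subspaceD S_sub); last exact: br_pelts.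
by case: k => [|k]; [case: S_sub | apply: br_pelts].
Qed.

Lemma pelts_span z : S z.
Proof.
have [pr hpr] := pr_ex.
apply: (free_generated hfree S_sub br_pelts pmap_pelts hpr).
  move=> g x Sx; apply: (@lspanS _ _ (pelts `&` comp g)); first by move=> ? [].
  apply: (projections_lspan hpr) Sx => _ [[w k] /= hw ->].
  by eexists; apply: (pelt_comp f iota_comp k (lyndon_neq0 hw)).
by move=> x; apply: sub_lspan; exists ([:: x], 0%N).
Qed.

Section Graded.
Variables (Lam : addSemigroupType) (degL : X -> Lam) (V : Lam -> set L).
Hypothesis hV : is_Lam_grading iota degL V.

(** The bracketing of a word of degree [l] lies in [V l]. *)
Lemma bracketing_deg w l : wdeg degL w = Some l -> V l (bracketing w).
Proof.
case: hV => _ V_iota V_br _.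
have [n] := ubnP (size w); elim: n w l => // n IH w l sw hl.
have wn := wdeg_neq0 hl.
case: (ltnP 1 (size w)) => s1; last first.
  case: w s1 {sw} wn hl => [|x [|]] // _ _; rewrite /wdeg big_seq1 => -[<-].
  exact: V_iota.
have /andP[m0 ms] := min_suffix_bounds f s1.
rewrite bracketing_split //; set m := min_suffix f w in m0 ms *.
move: hl; rewrite -{1}(cat_take_drop m w) wdeg_cat.
have st : size (take m w) = m by apply: size_takel; apply: ltnW.
have sd : size (drop m w) = (size w - m)%N by rewrite size_drop.
have [|l1 e1] := @wdeg_some _ _ degL (take m w).
  by case: (take m w) st m0 => // <-.
have [|l2 e2] := @wdeg_some _ _ degL (drop m w).
  by case: (drop m w) sd ms => //= h; rewrite -subn_gt0 -h.
rewrite e1 e2 => -[<-]; apply: V_br; apply: IH => //; rewrite ?st ?sd; lia.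
Qed.

Lemma pelt_deg w k l : wdeg degL (wpow (p ^ k) w) = Some l -> V l (pelt w k).
Proof.
case: (hV) => _ _ _ V_pmap; elim: k l => [|k IH] l.
  by rewrite wpow1; apply: bracketing_deg.
move=> hl; have := wdeg_neq0 hl; rewrite wpow_eq0 // => wn.
have [|m hm] := @wdeg_some _ _ degL (wpow (p ^ k) w); first by rewrite wpow_eq0.
move: hl; rewrite expnS -wpowM (wdeg_wpow _ hm); last exact: (p_gt0 1).
case=> <-; apply: V_pmap; first exact: IH.
exact: (pelt_comp f iota_comp).
Qed.

(** The elements [pelt w k] of degree [l] form a basis of [V l]. *)
Lemma graded_has_dim l (s : seq (seq X * nat)) : uniq s ->
  (forall i, i \in s <-> lyndon i.1 /\ wdeg degL (wpow (p ^ i.2) i.1) = Some l) ->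
  has_dim (V l) (size s).
Proof.
move=> us hs; pose b (i : 'I_(size s)) := let j := tnth (in_tuple s) i in pelt j.1 j.2.
have hb i : b i = (fun j => pelt j.1 j.2) (tnth (in_tuple s) i) by [].
have V_dir : direct_decomposition V by case: hV.
have V_sub : subspace (V l) by case: V_dir.
have Vb i : V l (b i).
  by have [_ hi] := (hs _).1 (mem_tnth i (in_tuple s)); apply: pelt_deg.
exists b; split=> // x Vx.
have [pr [lp pC pid p0 _]] := direct_projections V_dir.
pose T := [set y | exists c : 'rV[F]_(size s), y = \sum_(i < size s) c 0 i *: b i].
have T_sub : subspace T.
  split; first by exists 0; rewrite big1 // => i _; rewrite mxE scale0r.
  move=> a _ _ [c ->] [d ->]; exists (a *: c + d).
  rewrite scaler_sumr -big_split; apply: eq_bigr => i _.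
  by rewrite !mxE scalerDl scalerA.
have [c hc] : T x.
  rewrite -(pid _ _ Vx); apply: (lspan_map (lp l) T_sub) (pelts_span x).
  move=> _ [[w k] /= hw ->].
  have [|m hm] := @wdeg_some _ _ degL (wpow (p ^ k) w).
    by rewrite wpow_eq0 // (lyndon_neq0 hw).
  have Vm := pelt_deg hm; case: (eqVneq l m) => [e|/p0 -> //]; last by case: T_sub.
  rewrite pid; last (by rewrite e); have /hs is_ : lyndon (w, k).1 /\
    wdeg degL (wpow (p ^ (w, k).2) (w, k).1) = Some l by rewrite e.
  have hi : (index (w, k) s < size s)%N by rewrite index_mem.
  exists (\row_i (i == Ordinal hi)%:R).
  rewrite (bigD1 (Ordinal hi)) //= mxE eqxx scale1r big1 ?addr0 => [|i /negbTE ne].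
    by rewrite /b (tnth_nth (w, k)) /= nth_index.
  by rewrite mxE ne scale0r.
exists c; split=> // d hd; apply/rowP => i.
(* The difference of two coefficient vectors, as a function of the elements of
   the list [s]. *)
pose e (j : seq X * nat) : F :=
  if insub (index j s) is Some i then c 0 i - d 0 i else 0.
have he (k : 'I_(size s)) : e (tnth (in_tuple s) k) = c 0 k - d 0 k.
  rewrite /e (tnth_nth (tnth (in_tuple s) k)) /= index_uniq //.
  by case: insubP => [k' _ /val_inj -> //|]; rewrite ltn_ord.
apply/eqP; rewrite -subr_eq0 -he; apply/eqP.
have s_lyndon : {in s, forall j, lyndon j.1} by move=> j /hs[].
apply: (pelt_free hp hgamma hGplus f_inj hfree us s_lyndon) (mem_tnth i (in_tuple s)).
rewrite big_tnth; under eq_bigr => k _ do rewrite he scalerBl.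
by rewrite sumrB; apply/eqP; rewrite subr_eq0; apply/eqP; rewrite -hc.
Qed.
End Graded.
End FreeBasis.

(** * Divisor sums of the Moebius function *)

Section MoebiusSums.
Implicit Types (p q m n s a : nat).

Lemma logn_mul_coprime q s m : prime q -> coprime q m -> (0 < m)%N ->
  logn q (q ^ s * m)%N = s.
Proof.
move=> qp qm m0; rewrite lognM // ?expn_gt0 ?prime_gt0 // pfactorK //.
by rewrite logn_coprime ?addn0.
Qed.

(** The divisors of [q ^ a * m], for a prime [q] prime to [m], are the products of
    a power of [q] and a divisor of [m]. *)
Lemma divisors_pfactor q a m : prime q -> coprime q m -> (0 < m)%N ->
  perm_eq (divisors (q ^ a * m)%N) [seq (q ^ s * d)%N | s <- iota 0 a.+1, d <- divisors m].
Proof.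
move=> qp qm m0; have D0 : (0 < q ^ a * m)%N by rewrite muln_gt0 expn_gt0 prime_gt0.
have div_cop d : d \in divisors m -> coprime q d /\ (0 < d)%N.
  rewrite -dvdn_divisors // => dm; split; last exact: dvdn_gt0 dm.
  exact: coprime_dvdr dm qm.
apply: uniq_perm; first exact: divisors_uniq.
  apply: allpairs_uniq; [exact: iota_uniq | exact: divisors_uniq |].
  move=> [s d] [t e] /allpairsP[[s' d'] [_ /div_cop[h1 h2] [-> ->]]].
  move=> /allpairsP[[t' e'] [_ /div_cop[h3 h4] [-> ->]]] /= E.
  have := congr1 (logn q) E; rewrite !logn_mul_coprime // => st.
  by move/eqP: E; rewrite st eqn_pmul2l ?expn_gt0 ?prime_gt0 // => /eqP ->.
move=> n; rewrite -dvdn_divisors //; apply/idP/allpairsP => [nD|].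
  have n0 := dvdn_gt0 D0 nD.
  have [k qk ek] := pfactor_coprime qp n0.
  exists (logn q n, k); split; last by rewrite mulnC.
    change (logn q n \in iota 0 a.+1); rewrite mem_iota add0n ltnS leq0n /=.
    by have := dvdn_leq_log q D0 nD; rewrite logn_mul_coprime.
  change (k \in divisors m); rewrite -dvdn_divisors // -(@Gauss_dvdr k (q ^ a)%N).
    by apply: dvdn_trans nD; rewrite ek dvdn_mulr.
  by rewrite coprime_sym coprimeXl.
move=> [[s d] [hs hd ->]]; change (is_true (s \in iota 0 a.+1)) in hs.
change (is_true (d \in divisors m)) in hd; rewrite /=.
rewrite mem_iota add0n ltnS /= in hs; rewrite -dvdn_divisors // in hd.
by apply: dvdn_mul => //; apply: dvdn_exp2l.
Qed.

Lemma primes_pfactor q s m : prime q -> coprime q m -> (0 < m)%N ->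
  perm_eq (primes (q ^ s.+1 * m)%N) (q :: primes m).
Proof.
move=> qp qm m0; apply: uniq_perm; first exact: primes_uniq.
  rewrite /= primes_uniq andbT mem_primes qp m0 /=.
  by rewrite -prime_coprime.
move=> r; rewrite primesM // ?expn_gt0 ?prime_gt0 // primesX // primes_prime //.
by rewrite !inE.
Qed.

Lemma moebius_pfactor q s m : prime q -> coprime q m -> (0 < m)%N ->
  moebius (q ^ s.+1 * m)%N = if s == 0%N then - moebius m else 0.
Proof.
move=> qp qm m0; rewrite /moebius (perm_all _ (primes_pfactor s qp qm m0)).
rewrite (perm_size (primes_pfactor s qp qm m0)) /= logn_mul_coprime //.
have -> : all (fun r => logn r (q ^ s.+1 * m)%N == 1)%N (primes m) =
          all (fun r => logn r m == 1)%N (primes m).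
  apply: eq_in_all => r; rewrite mem_primes => /and3P[rp _ rm].
  rewrite lognM // ?expn_gt0 ?prime_gt0 // lognX (@logn_coprime r q) ?muln0 //.
  rewrite prime_coprime // dvdn_prime2 //; apply: contraTneq qm => <-.
  by rewrite prime_coprime // rm.
rewrite eqSS; case: eqP => //= _; case: ifP => _; last by rewrite oppr0.
by rewrite exprS mulN1r.
Qed.

Lemma moebius_p_pfactor p s m : prime p -> coprime p m -> (0 < m)%N ->
  moebius_p p (p ^ s * m)%N =
  moebius m * (if s is s'.+1 then (p ^ s)%N%:Z - (p ^ s')%N%:Z else 1).
Proof.
move=> pp pm m0; rewrite /moebius_p logn_mul_coprime //.
case: s => [|s].
  by rewrite expn0 mul1n mulr1 -[(p %| m)%N]negbK -prime_coprime // pm.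
rewrite expnS -mulnA dvdn_mulr // mulnA -expnS mulKn ?expn_gt0 ?prime_gt0 //.
by rewrite -subzn // leq_exp2l ?prime_gt1.
Qed.

(** The divisors of [q ^ a.+1 * k], for a prime [q] prime to [k], cancel in pairs
    [d], [q * d]. *)
Lemma sum_moebius m : (0 < m)%N ->
  \sum_(d <- divisors m) moebius d = (m == 1%N)%:R.
Proof.
case: (eqVneq m 1%N) => [-> _|m1 m0]; first by rewrite (_ : divisors 1 = [:: 1%N]) // big_seq1.
have qp : prime (pdiv m) by apply: pdiv_prime; lia.
have [k qk ek] := pfactor_coprime qp m0.
have : (0 < logn (pdiv m) m)%N by rewrite logn_gt0 mem_primes qp m0 pdiv_dvd.
set q := pdiv m in qp qk ek *; case: (logn q m) ek => // a ek _.
have k0 : (0 < k)%N by move: m0; rewrite ek; case: (k).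
rewrite ek mulnC (perm_big _ (divisors_pfactor a.+1 qp qk k0)).
rewrite big_allpairs_dep [iota 0 a.+2]/= !big_cons /=.
rewrite [X in _ + (_ + X)]big1_seq ?addr0 => [|s]; last first.
  rewrite /= mem_iota => /andP[s2 _]; rewrite big_seq big1 // => d.
  rewrite -dvdn_divisors // => dk; case: s s2 => [|[|s]] // _.
  by rewrite moebius_pfactor // ?(coprime_dvdr dk) // (dvdn_gt0 k0 dk).
rewrite -big_split big_seq big1 // => d.
rewrite -dvdn_divisors // => dk /=.
rewrite expn0 mul1n moebius_pfactor ?subrr // ?(coprime_dvdr dk) //.
exact: dvdn_gt0 dk.
Qed.

(** The divisor sum of [moebius_p] at [m] is [m] when [m] is a power of [p], and
    0 otherwise. *)
Lemma sum_moebius_p p m : prime p -> (0 < m)%N ->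
  \sum_(d <- divisors m) moebius_p p d = if m == (p ^ logn p m)%N then m%:Z else 0.
Proof.
move=> pp m0; have [k pk ek] := pfactor_coprime pp m0.
set a := logn p m in ek *.
have k0 : (0 < k)%N by move: m0; rewrite ek; case: (k).
have pa0 : (0 < p ^ a)%N by rewrite expn_gt0 prime_gt0.
rewrite [in LHS]ek mulnC (perm_big _ (divisors_pfactor a pp pk k0)).
rewrite big_allpairs_dep /=.
have -> : \sum_(s <- iota 0 a.+1) \sum_(d <- divisors k) moebius_p p (p ^ s * d)%N =
    \sum_(s <- iota 0 a.+1) (k == 1%N)%:R *
      (if s is s'.+1 then (p ^ s)%N%:Z - (p ^ s')%N%:Z else 1).
  apply: eq_bigr => s _; rewrite -sum_moebius // mulr_suml.
  rewrite !big_seq; apply: eq_bigr => d; rewrite -dvdn_divisors // => dk.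
  by rewrite moebius_p_pfactor // ?(coprime_dvdr dk) // (dvdn_gt0 k0 dk).
rewrite -mulr_sumr.
have -> : \sum_(s <- iota 0 a.+1)
    (if s is s'.+1 then (p ^ s)%N%:Z - (p ^ s')%N%:Z else 1) = (p ^ a)%N%:Z.
  elim: (a) => [|b IH]; first by rewrite big_seq1.
  by rewrite -addn1 iotaD big_cat IH /= big_seq1 add0n addrC subrK.
have -> : (m == p ^ a)%N = (k == 1)%N.
  by rewrite ek -[X in _ == X]mul1n eqn_pmul2r.
by case: eqP => [k1|_]; rewrite ?mul0r // mul1r ek k1 mul1n.
Qed.
End MoebiusSums.

(** * Counting words *)

Section FiniteSums.
Variable R : numFieldType.

Lemma fsum_bounded (K : nat) (E : nat -> R) : (forall n, (K < n)%N -> E n = 0) ->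
  \sum_(n \in [set n : nat | (0 < n)%N]) E n = \sum_(1 <= n < K.+1) E n.
Proof.
move=> h; rewrite (fsbig_seq _ _ (iota_uniq _ _)); apply/esym/fsbig_widen.
  by move=> n /=; rewrite mem_index_iota => /andP[].
move=> n /= [n0 /negP]; rewrite mem_index_iota n0 /= -leqNgt => /h.
by [].
Qed.

Lemma sum_nat_pred1 (K m : nat) (E : nat -> R) :
  \sum_(1 <= n < K.+1 | n == m) E n = if (0 < m <= K)%N then E m else 0.
Proof.
rewrite -big_filter; case: ifP => hm.
  by rewrite filter_pred1_uniq ?iota_uniq ?mem_index_iota // big_seq1.
rewrite big_filter big_nat_cond big1 // => n /andP[h /eqP e].
by move: h; rewrite e ltnS hm.
Qed.

(** The number of elements of a finite set, as a sum. *)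
Definition fcard (T : choiceType) (A : set T) : R := \sum_(x \in A) (1 : R).

Lemma fcardE (T : choiceType) (A : set T) : finite_set A ->
  (#|` fset_set A|)%:R = fcard A.
Proof.
move=> fA; rewrite /fcard fsbig_finite //.
by rewrite big_const_seq count_predT iter_addr_0.
Qed.

Lemma fcard_bij (T U : choiceType) (h : T -> U) (A : set T) (B : set U) :
  set_bij A B h -> fcard A = fcard B.
Proof. by move=> hb; rewrite /fcard (reindex_fsbig _ _ _ _ hb). Qed.

Lemma fcard_setX (T U : choiceType) (A : set T) (B : set U) :
  finite_set A -> finite_set B -> fcard (A `*` B) = fcard A * fcard B.
Proof.
move=> fA fB; rewrite /fcard -(pair_fsbig _ (fun _ _ => 1)) // mulr_fsuml.
by apply: eq_fsbigr => x _; rewrite mul1r.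
Qed.

(** A finite set is counted by the fibers of a map. *)
Lemma fcard_fibers (T I : choiceType) (h : T -> I) (D : set I) (B : set T) :
  finite_set D -> finite_set B -> (forall x, B x -> D (h x)) ->
  \sum_(i \in D) fcard (B `&` [set x | h x = i]) = fcard B.
Proof.
move=> fD fB hD; rewrite /fcard.
under eq_fsbigr => i _ do rewrite fsbig_mkcondr.
rewrite exchange_fsbig //; apply: eq_fsbigr => x /set_mem Bx.
transitivity (\sum_(i \in D) (if i \in [set h x] then (1 : R) else 0)).
  apply: eq_fsbigr => i _; congr (if _ then _ else _).
  by apply/idP/idP => /set_mem e; apply/mem_set; rewrite /= e.
rewrite -fsbig_mkcondr (_ : D `&` [set h x] = [set h x]) ?fsbig_set1 //.
by apply/seteqP; split=> i; [case | move=> ->; split=> //; apply: hD].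
Qed.

Lemma fcard_seq (T : choiceType) (s : seq T) (P : pred T) (A : set T) : uniq s ->
  (forall x, A x <-> x \in s /\ P x) -> fcard A = \sum_(x <- s | P x) 1.
Proof.
move=> us hA; rewrite /fcard -[in RHS]big_filter (fsbig_seq _ _ (filter_uniq P us)).
apply: eq_fsbigl; rewrite predeqE => x /=; rewrite mem_filter.
by split=> [/hA[-> ->]|/andP[h1 h2]] //; apply/hA.
Qed.
End FiniteSums.

Section WordCounts.
Variables (X : choiceType) (Lam : addSemigroupType) (degL : X -> Lam).
Hypothesis hLam : finitely_decomposable Lam.
Hypothesis hX : forall l : Lam, finite_set [set x | degL x = l].
Implicit Types (u v w : seq X) (l m : Lam).
Local Notation wdeg := (wdeg degL).

Lemma wdeg_cons x w : wdeg (x :: w) = oadd Lam (Some (degL x)) (wdeg w).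
Proof. exact: big_cons. Qed.

(** The degree of a nonempty word is a sum as in [finitely_decomposable]. *)
Lemma wdeg_foldl x w : wdeg (x :: w) = Some (foldl +%R (degL x) (map degL w)).
Proof.
have h l : oadd Lam (Some l) (wdeg w) = Some (foldl +%R l (map degL w)).
  elim: w l => [|y w IH] l; first by rewrite /wdeg big_nil Monoid.mulm1.
  by rewrite wdeg_cons Monoid.mulmA; apply: IH.
by rewrite wdeg_cons h.
Qed.

Lemma finite_map_eq (b : seq Lam) : finite_set [set w | map degL w = b].
Proof.
elim: b => [|l b IH].
  apply: (sub_finite_set _ (finite_set1 [::])) => w /=.
  by case: w.
apply: (sub_finite_set _ (finite_image2 cons (hX l) IH)) => -[//|x w] /= [h1 h2].
by exists x => //; exists w.
Qed.

Lemma finite_wdeg l : finite_set [set w | wdeg w = Some l].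
Proof.
have fD := hLam l.
have fF (s : Lam * seq Lam) : finite_set [set w | wdeg w = Some l /\
    if w is x :: w' then degL x = s.1 /\ map degL w' = s.2 else False].
  apply: (sub_finite_set _ (finite_image2 cons (hX s.1) (finite_map_eq s.2))).
  by move=> [|x w] /= [] // _ [h1 h2]; exists x => //; exists w.
apply: (sub_finite_set _ (bigcup_finite fD (fun s _ => fF s))) => w /= hw.
case: w hw => [|x w] hw; first by rewrite /wdeg big_nil in hw.
exists (degL x, map degL w) => //=.
by move: hw; rewrite wdeg_foldl => -[].
Qed.

Lemma wdeg_size_bound l : exists K, forall w, wdeg w = Some l -> (size w <= K)%N.
Proof.
exists (\max_(w <- fset_set [set w | wdeg w = Some l]) size w)%N => w hw.
rewrite (big_rem w) /= ?leq_maxl // in_fset_set; last exact: finite_wdeg.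
exact: mem_set.
Qed.

(** The words of which some power has degree [l]. *)
Definition root_words l : set (seq X) :=
  [set w | exists2 n, (0 < n)%N & wdeg (wpow n w) = Some l].

Lemma finite_root_words l : finite_set (root_words l).
Proof.
have [K hK] := wdeg_size_bound l.
apply: (sub_finite_set _ (finite_image2 (fun v i => take i v) (finite_wdeg l)
   (finite_II K.+1))) => w [n n0 hn].
exists (wpow n w) => //; exists (size w); last first.
  by case: n n0 {hn} => // n _; rewrite wpowS take_size_cat.
rewrite /= ltnS (leq_trans _ (hK _ hn)) // size_wpow.
by case: n n0 {hn} => // n _; rewrite mulSn leq_addr.
Qed.

(** The words [w] of length [N] such that [n] times the degree of [w] is [l]. *)
Definition words n N l : set (seq X) :=
  [set w | size w = N /\ wdeg (wpow n w) = Some l].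

Lemma finite_words n N l : (0 < n)%N -> finite_set (words n N l).
Proof.
move=> n0; apply: (sub_finite_set _ (finite_root_words l)) => w [_ hw].
by exists n.
Qed.

Lemma wdeg_wpow_cons n x w :
  wdeg (wpow n (x :: w)) = oadd Lam (wdeg (wpow n [:: x])) (wdeg (wpow n w)).
Proof.
rewrite -wdeg_cat; apply: perm_wdeg; apply/permP => a.
have count_wpow v : count a (wpow n v) = (n * count a v)%N.
  by elim: n => // n IH; rewrite wpowS count_cat IH mulSn.
by rewrite count_cat !count_wpow /= addn0 mulnDr.
Qed.

Lemma wdeg_wpow1 n x : (0 < n)%N -> wdeg (wpow n [:: x]) = Some (pmuln n (degL x)).
Proof. by move=> n0; apply: wdeg_wpow; rewrite // /wdeg big_seq1. Qed.

Lemma dilation_ch n l : (0 < n)%N ->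
  dilation n (ch_set degL) l = fcard _ [set x | pmuln n (degL x) = l].
Proof.
move=> n0; rewrite /dilation.
have fB : finite_set [set x | pmuln n (degL x) = l].
  have inj1 : {in (fun x => [:: x]) @^-1` words n 1 l &, injective (fun x : X => [:: x])}.
    by move=> x y _ _ [].
  have := finite_preimage inj1 (finite_words 1 l n0).
  apply: sub_finite_set => x /= hx; split=> //.
  by rewrite wdeg_wpow1 ?hx.
rewrite -(@fcard_fibers _ _ _ degL [set m | pmuln n m = l]) //; last first.
  have inj2 : {in (fun m => (m, nseq n.-1 m)) @^-1`
      [set s | foldl +%R s.1 s.2 = l] &, injective (fun m : Lam => (m, nseq n.-1 m))}.
    by move=> a b _ _ [].
  apply: (sub_finite_set _ (finite_preimage inj2 (hLam l))) => m /= <-.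
  have foldl_nseq k a : foldl +%R a (nseq k m) = iter k (+%R m) a.
    by elim: k a => // k IH a; rewrite iterSr -IH /= [a + m]Algebra.addrC.
  exact: foldl_nseq.
apply: eq_fsbigr => m /set_mem /= hm; rewrite /ch_set fcardE //.
congr fcard; apply/seteqP; split=> x /= => [e|[]//].
by rewrite e.
Qed.

(** Up to the sign, the coefficient of [l] in the [N]-th power of the dilation
    counts the words [w] of length [N] such that [n] times the degree of [w]
    is [l]. *)
Lemma fs_pow_dilation n N l : (0 < n)%N ->
  fs_pow (- dilation n (ch_set degL)) N.+1 l =
  (-1) ^+ N.+1 * fcard _ (words n N.+1 l).
Proof.
move=> n0; rewrite /fs_pow /=; set g := - dilation n _.
have gE m : g m = - fcard _ [set x | pmuln n (degL x) = m].
  by rewrite -dilation_ch.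
elim: N l => [|N IH] l.
  rewrite /= gE expr1 mulN1r; congr (- _).
  apply: (@fcard_bij _ _ _ (fun x => [:: x])); split.
  - by move=> x /= hx; split=> //; rewrite wdeg_wpow1 ?hx.
  - by move=> x y _ _ [].
  - move=> w [s1 hw]; case: w s1 hw => [|x [|]] // _.
    by rewrite wdeg_wpow1 // => -[hx]; exists x.
rewrite iterS /fs_mul.
pose C := [set q : X * seq X | size q.2 = N.+1 /\ wdeg (wpow n (q.1 :: q.2)) = Some l].
(* The default value [l] is irrelevant, as [q.2] is nonempty for [q] in [C]. *)
pose h (q : X * seq X) := (pmuln n (degL q.1), odflt l (wdeg (wpow n q.2))).
have hE q : C q -> exists m, [/\ wdeg (wpow n q.2) = Some m, h q = (pmuln n (degL q.1), m)
    & pmuln n (degL q.1) + m = l].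
  move=> [s]; rewrite wdeg_wpow_cons wdeg_wpow1 //.
  have [|m hm] := @wdeg_some _ _ degL (wpow n q.2); first by rewrite wpow_eq0 //; case: (q.2) s.
  by rewrite /h hm => -[e]; exists m.
have fD : finite_set [set m : Lam * Lam | m.1 + m.2 = l].
  have inj2 : {in (fun m : Lam * Lam => (m.1, [:: m.2])) @^-1`
      [set s | foldl +%R s.1 s.2 = l] &,
      injective (fun m : Lam * Lam => (m.1, [:: m.2]))}.
    by move=> [a b] [c d] _ _ [-> ->].
  exact: (finite_preimage inj2 (hLam l)).
have cons_inj : {in (fun q : X * seq X => q.1 :: q.2) @^-1` words n N.+2 l &,
    injective (fun q : X * seq X => q.1 :: q.2)}.
  by move=> [a b] [c d] _ _ [-> ->].
have fC : finite_set C.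
  have := finite_preimage cons_inj (finite_words N.+2 l n0).
  by apply: sub_finite_set => q [s hq]; split=> //=; rewrite s.
have <- : fcard rat C = fcard rat (words n N.+2 l).
  apply: (@fcard_bij _ _ _ (fun q => q.1 :: q.2)); split.
  - by move=> q [s hq]; split=> //=; rewrite s.
  - by move=> [a b] [c d] _ _ [-> ->].
  - move=> w [s hw]; case: w s hw => [|x w] // [s] hw.
    by exists (x, w).
rewrite -(@fcard_fibers _ _ _ h _ _ fD fC); last first.
  by move=> q /hE[m [_ -> /=]].
rewrite mulr_fsumr; apply: eq_fsbigr => m /set_mem /= hm.
rewrite gE IH.
have -> : C `&` [set q | h q = m] =
    [set x | pmuln n (degL x) = m.1] `*` words n N.+1 m.2.
  apply/seteqP; split=> [q [Cq hq]|q [q1 [s q2]]].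
    have [k [hk]] := hE q Cq; rewrite hq => em _; split; rewrite em //=.
    by split=> //; case: Cq.
  split; last by rewrite /= /h q1 q2 /=; case: (m).
  by split=> //; rewrite wdeg_wpow_cons wdeg_wpow1 // q1 q2 -hm.
have fA : finite_set [set x | pmuln n (degL x) = m.1].
  have inj1 : {in (fun x => [:: x]) @^-1` words n 1 m.1 &, injective (fun x : X => [:: x])}.
    by move=> x y _ _ [].
  have := finite_preimage inj1 (finite_words 1 m.1 n0).
  apply: sub_finite_set => x /= hx; split=> //.
  by rewrite wdeg_wpow1 ?hx.
rewrite fcard_setX //; last exact: finite_words.
by rewrite [in RHS]exprS mulN1r mulNr mulrCA mulNr.
Qed.

(** * The coefficient of the right-hand side *)

Section FixedDegree.
Variables (f : X -> nat) (l : Lam) (K : nat).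
Hypothesis f_inj : injective f.
Hypothesis hK : forall w, wdeg w = Some l -> (size w <= K)%N.
Local Notation lyndon := (lyndon f).

(** [deg_pow n w]: the [n]-th power of [w] has degree [l]. *)
Let deg_pow n w := wdeg (wpow n w) == Some l.
(** The finite list of the words to be considered. *)
Let Ws : seq (seq X) := fset_set (root_words l).

Let Ws_uniq : uniq Ws. Proof. exact: fset_uniq. Qed.

Let mem_Ws n w : (0 < n)%N -> deg_pow n w -> w \in Ws.
Proof.
move=> n0 /eqP hw; rewrite in_fset_set; last exact: finite_root_words.
by apply/mem_set; exists n.
Qed.

Let deg_pow_neq0 n w : deg_pow n w -> w != [::].
Proof.
move=> /eqP/wdeg_neq0; apply: contra => /eqP ->.
by rewrite -size_eq0 size_wpow muln0.
Qed.

Let deg_pow_bound n w : deg_pow n w -> (n * size w <= K)%N.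
Proof. by move=> /eqP/hK; rewrite size_wpow. Qed.

Let deg_pow_size n w : (0 < n)%N -> deg_pow n w -> (0 < size w <= K)%N.
Proof.
move=> n0 hw; rewrite lt0n size_eq0 (deg_pow_neq0 hw) /=.
by apply: leq_trans (deg_pow_bound hw); rewrite leq_pmull.
Qed.

Let deg_pow_exp n w : deg_pow n w -> (n <= K)%N.
Proof.
move=> hw; apply: leq_trans (deg_pow_bound hw).
by rewrite leq_pmulr // lt0n size_eq0 (deg_pow_neq0 hw).
Qed.

Let fcard_words n N : (0 < n)%N ->
  fcard rat (words n N l) = \sum_(w <- Ws | (size w == N) && deg_pow n w) 1.
Proof.
move=> n0; apply: fcard_seq => // w; split=> [[/eqP s /eqP hw]|[_ /andP[/eqP s /eqP hw]]] //.
by rewrite (mem_Ws n0) // s.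
Qed.

(** The coefficient of [l] in the logarithm; the words of length [N] contribute
    through the [N]-th power, with weight [1 / N]. *)
Lemma ln1p_dilation n : (0 < n)%N ->
  ln1p (- dilation n (ch_set degL)) l =
  - \sum_(w <- Ws | deg_pow n w) (size w)%:R^-1.
Proof.
move=> n0; rewrite /ln1p.
have termE N : (0 < N)%N ->
    (-1) ^+ N.-1 / N%:R * fs_pow (- dilation n (ch_set degL)) N l =
    - \sum_(w <- Ws | deg_pow n w) (if N == size w then N%:R^-1 else 0).
  case: N => // N _; rewrite fs_pow_dilation // fcard_words //=.
  have -> : (-1) ^+ N / N.+1%:R * ((-1) ^+ N.+1 *
      \sum_(w <- Ws | (size w == N.+1) && deg_pow n w) 1) =
      - (N.+1%:R^-1 * \sum_(w <- Ws | (size w == N.+1) && deg_pow n w) 1) :> rat.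
    rewrite exprS mulN1r !mulNr mulrN; congr (- _).
    rewrite mulrA [_ / _]mulrC -[_ * _ * _ ^+ _]mulrA -exprMn mulrNN mulr1 expr1n.
    by rewrite mulr1.
  congr (- _); rewrite mulr_sumr big_mkcondl /=; apply: eq_bigr => w _.
  by rewrite mulr1 eq_sym.
rewrite (@fsum_bounded _ K) => [|N hN]; last first.
  rewrite termE ?(leq_ltn_trans _ hN) // big1 ?oppr0 // => w hw.
  case: eqP => // e; have /andP[_] := deg_pow_size n0 hw.
  by rewrite -e leqNgt hN.
rewrite big_nat_cond; under eq_bigr => N /andP[/andP[N0 _] _] do rewrite termE //.
rewrite -big_nat_cond sumrN exchange_big /=; congr (- _); apply: eq_bigr => w hw.
by rewrite -big_mkcond sum_nat_pred1 (deg_pow_size n0 hw).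
Qed.

(** The words in the sum are, uniquely, the rotations of the powers of Lyndon
    words; the [size u] rotations of the [d]-th power of [u] contribute
    [1 / (d * size u)] each. *)
Lemma necklace_sum n : (0 < n)%N ->
  \sum_(w <- Ws | deg_pow n w) (size w)%:R^-1 =
  \sum_(u <- [seq w <- Ws | lyndon w])
    \sum_(1 <= d < K.+1 | deg_pow (n * d) u) d%:R^-1 :> rat.
Proof.
move=> n0; set Lyn := [seq w <- Ws | lyndon w].
pose pairs := [seq (u, d) | u <- Lyn, d <- [seq d <- index_iota 1 K.+1 | deg_pow (n * d) u]].
pose triples := [seq (x, r) | x <- pairs, r <- iota 0 (size x.1)].
pose rotw (y : (seq X * nat) * nat) := rot y.2 (wpow y.1.2 y.1.1).
have pairsP u d : (u, d) \in pairs <-> [/\ lyndon u, (0 < d)%N & deg_pow (n * d) u].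
  split.
    move=> /allpairsPdep[u' [d' [hu' + [-> ->]]]]; rewrite mem_filter => /andP[h].
    rewrite mem_index_iota => /andP[d0 _]; split=> //.
    by move: hu'; rewrite mem_filter => /andP[].
  move=> [hu d0 h]; have nd0 : (0 < n * d)%N by rewrite muln_gt0 n0.
  apply/allpairsPdep; exists u, d; split=> //.
    by rewrite mem_filter hu (mem_Ws nd0 h).
  rewrite mem_filter h mem_index_iota d0 /= ltnS.
  by apply: leq_trans (deg_pow_exp h); rewrite leq_pmull.
have triplesP u d r : ((u, d), r) \in triples <->
    [/\ lyndon u, (0 < d)%N, deg_pow (n * d) u & (r < size u)%N].
  split.
    move=> /allpairsPdep[[u' d'] [r' [/pairsP[h1 h2 h3] + [-> -> ->]]]].
    by rewrite mem_iota.
  move=> [h1 h2 h3 h4]; apply/allpairsPdep; exists (u, d), r; split=> //.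
    exact/pairsP.
  by rewrite mem_iota.
have deg_rot u d r : deg_pow n (rot r (wpow d u)) = deg_pow (n * d) u.
  rewrite /deg_pow -wpowM; congr (_ == _); apply: perm_wdeg; apply/permP => a.
  have count_wpow v : count a (wpow n v) = (n * count a v)%N.
    by elim: n {n0 pairs triples pairsP triplesP} => // m IH; rewrite wpowS count_cat IH mulSn.
  by rewrite !count_wpow; congr (_ * _)%N; apply/permP; rewrite perm_rot.
have pairs_uniq : uniq pairs.
  apply: allpairs_uniq_dep => [|u _|]; rewrite ?filter_uniq ?iota_uniq //.
  by move=> [? ?] [? ?] _ _ /= [-> ->].
have E : perm_eq [seq w <- Ws | deg_pow n w] [seq rotw y | y <- triples].
  apply: uniq_perm; first by rewrite filter_uniq.
    rewrite map_inj_in_uniq.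
      apply: allpairs_uniq_dep => [//|u _|]; first exact: iota_uniq.
      by move=> [? ?] [? ?] _ _ /= [-> ->].
    move=> [[u d] r] [[u' d'] r'] /triplesP[h1 h2 _ h3] /triplesP[h1' h2' _ h3'].
    by move=> /(necklace_inj f_inj h1 h2 h3 h1' h2' h3')[-> -> ->].
  move=> w; rewrite mem_filter; apply/andP/mapP.
    move=> [hw _]; have [u [d [r [h1 h2 h3 ew]]]] := necklace_ex f_inj (deg_pow_neq0 hw).
    exists ((u, d), r) => //; apply/triplesP; split=> //.
    by rewrite -(deg_rot _ _ r) -ew.
  move=> [[[u d] r] /triplesP[h1 h2 h3 h4] ->].
  have hw : deg_pow n (rotw (u, d, r)) by rewrite /rotw deg_rot.
  by split=> //; apply: mem_Ws hw.
rewrite -big_filter (perm_big _ E) big_map big_allpairs_dep /=.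
rewrite -[RHS]/(\sum_(u <- Lyn) _).
transitivity (\sum_(x <- pairs) x.2%:R^-1 : rat).
  rewrite !big_seq; apply: eq_bigr => -[u d] /pairsP[h1 h2 _] /=.
  have su : (0 < size u)%N by rewrite lt0n size_eq0 (lyndon_neq0 h1).
  rewrite (eq_bigr (fun=> (d * size u)%:R^-1)) => [|r _]; last first.
    by rewrite /rotw size_rot size_wpow.
  rewrite big_const_seq count_predT size_iota iter_addr_0 -[LHS]mulr_natr natrM.
  by rewrite invfM mulfVK // Num.Theory.pnatr_eq0 -lt0n.
rewrite big_allpairs_dep /=; apply: eq_bigr => u _.
by rewrite big_filter.
Qed.

Variable p : nat.
Hypothesis p_pr : prime p.

(** The pairs [(w, k)] with [w] Lyndon and [p ^ k] times the degree of [w]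
    equal to [l]; they index the basis of the component of degree [l]. *)
Definition basis_index : seq (seq X * nat) :=
  [seq (u, k) | u <- [seq w <- Ws | lyndon w],
                k <- [seq k <- iota 0 K.+1 | deg_pow (p ^ k) u]].

Let p_gt0 k : (0 < p ^ k)%N. Proof. by rewrite expn_gt0 prime_gt0. Qed.

Lemma basis_index_uniq : uniq basis_index.
Proof.
apply: allpairs_uniq_dep => [|u _|]; rewrite ?filter_uniq ?iota_uniq //.
by move=> [? ?] [? ?] _ _ /= [-> ->].
Qed.

Lemma basis_indexP i : i \in basis_index <->
  lyndon i.1 /\ wdeg (wpow (p ^ i.2) i.1) = Some l.
Proof.
case: i => u k; split.
  move=> /allpairsPdep[u' [k' [hu' + [-> ->]]]]; rewrite mem_filter => /andP[/eqP h _].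
  by split=> //; move: hu'; rewrite mem_filter => /andP[].
move=> [hu /eqP h]; apply/allpairsPdep; exists u, k; split=> //.
  by rewrite mem_filter hu (mem_Ws (p_gt0 k) h).
rewrite mem_filter [deg_pow _ _]h mem_iota /= add0n ltnS.
by apply: leq_trans (deg_pow_exp h); apply: ltnW; rewrite ltn_expl ?prime_gt1.
Qed.

(** The double sum over the exponents, regrouped by their product [D]: the
    divisor sums of [moebius_p] leave only the powers of [p]. *)
Lemma sum_moebius_p_exponents u :
  \sum_(1 <= n < K.+1) \sum_(1 <= d < K.+1 | deg_pow (n * d) u)
    ((moebius_p p n)%:~R / n%:R * d%:R^-1) =
  (size [seq k <- iota 0 K.+1 | deg_pow (p ^ k) u])%:R :> rat.
Proof.
set ks := [seq k <- iota 0 K.+1 | _].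
pose c n D : rat := (moebius_p p n)%:~R / D%:R.
transitivity (\sum_(1 <= n < K.+1) \sum_(1 <= D < K.+1 | deg_pow D u)
    (if (n %| D)%N then c n D else 0)).
  apply: eq_big_nat => n /andP[n0 _].
  transitivity (\sum_(1 <= d < K.+1) \sum_(1 <= D < K.+1 | deg_pow D u)
      (if D == (n * d)%N then c n D else 0)).
    rewrite [LHS]big_mkcond /=; apply: eq_bigr => d _.
    rewrite -big_mkcondr /= (eq_bigl (fun D => (D == n * d)%N && deg_pow (n * d) u)); last first.
      by move=> D /=; rewrite andbC; case: eqP => [->|].
    rewrite big_mkcondr /= sum_nat_pred1; case: ifP => h; last by case: ifP.
    have nd := deg_pow_exp h.
    case: (posnP d) => [d0|d0]; first by rewrite d0 muln0 /= invr0 mulr0.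
    by rewrite muln_gt0 n0 d0 nd /c natrM invfM mulrA.
  rewrite exchange_big /= [LHS]big_nat_cond [RHS]big_nat_cond; apply: eq_bigr => D /andP[/andP[D0 DK] _].
  case: ifP => nD; last first.
    rewrite big1 // => d _; case: eqP => // e.
    by rewrite e dvdn_mulr in nD.
  rewrite (eq_bigr (fun d => if d == (D %/ n)%N then c n D else 0)); last first.
    move=> d _; congr (if _ then _ else _); rewrite -{1}(divnK nD) mulnC.
    by rewrite eqn_pmul2l // eq_sym.
  rewrite -big_mkcond sum_nat_pred1 divn_gt0 // (dvdn_leq D0 nD) /=.
  by rewrite (leq_trans (leq_div _ _)).
rewrite exchange_big /=.
transitivity (\sum_(1 <= D < K.+1 | deg_pow D u)
    (if D == (p ^ logn p D)%N then 1 else 0) : rat).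
  rewrite [LHS]big_nat_cond [RHS]big_nat_cond; apply: eq_bigr => D /andP[/andP[D0 DK] _].
  rewrite -big_mkcond /= -mulr_suml.
  have -> : \sum_(1 <= n < K.+1 | (n %| D)%N) (moebius_p p n)%:~R =
      (\sum_(n <- divisors D) moebius_p p n)%:~R :> rat.
    rewrite (big_morph (fun z : int => z%:~R : rat) (@intrD _) (mulr0z _)).
    rewrite -[LHS]big_filter; apply: perm_big; apply: uniq_perm.
    - by rewrite filter_uniq ?iota_uniq.
    - exact: divisors_uniq.
    move=> n; rewrite mem_filter mem_index_iota -dvdn_divisors //.
    case: (boolP (n %| D)%N) => // nD; rewrite (dvdn_gt0 D0 nD) ltnS.
    exact: leq_trans (dvdn_leq D0 nD) DK.
  rewrite sum_moebius_p //; case: ifP => _; last by rewrite mul0r.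
  by rewrite divff // Num.Theory.pnatr_eq0 -lt0n.
rewrite -big_mkcondr -big_filter.
rewrite (perm_big [seq (p ^ k)%N | k <- ks]) /=.
  by rewrite big_map big_const_seq count_predT iter_addr_0.
apply: uniq_perm; first by rewrite filter_uniq ?iota_uniq.
  rewrite map_inj_uniq /ks ?filter_uniq ?iota_uniq // => i j /eqP.
  by rewrite eqn_exp2l ?prime_gt1 // => /eqP.
move=> D; rewrite mem_filter mem_index_iota; apply/idP/mapP.
  move=> /andP[/andP[h /eqP eD] /andP[D0 DK]]; exists (logn p D) => //.
  rewrite /ks mem_filter -eD h mem_iota add0n.
  by apply: leq_trans DK; rewrite {2}eD ltnS ltnW // ltn_expl ?prime_gt1.
move=> [k]; rewrite /ks mem_filter => /andP[h _] ->.
by rewrite h pfactorK // eqxx p_gt0 ltnS (deg_pow_exp h).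
Qed.

(** The coefficient of [l] in the right-hand side is the number of basis elements
    of degree [l]. *)
Lemma formula_basis_index :
  - \sum_(n \in [set n : nat | (0 < n)%N])
      ((moebius_p p n)%:~R / n%:R * ln1p (- dilation n (ch_set degL)) l) =
  (size basis_index)%:R.
Proof.
rewrite (@fsum_bounded _ K) => [|n hn]; last first.
  rewrite ln1p_dilation ?(leq_ltn_trans _ hn) // big1 ?oppr0 ?mulr0 // => w hw.
  by have := deg_pow_exp hw; rewrite leqNgt hn.
rewrite -sumrN.
transitivity (\sum_(1 <= n < K.+1) \sum_(u <- [seq w <- Ws | lyndon w])
    \sum_(1 <= d < K.+1 | deg_pow (n * d) u)
      ((moebius_p p n)%:~R / n%:R * d%:R^-1 : rat)).
  apply: eq_big_nat => n /andP[n0 _].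
  rewrite ln1p_dilation // necklace_sum // mulrN opprK mulr_sumr.
  by apply: eq_bigr => u _; rewrite mulr_sumr.
rewrite exchange_big -sum1_size natr_sum big_allpairs_dep /=.
apply: eq_bigr => u _.
by rewrite sum_moebius_p_exponents -sum1_size natr_sum.
Qed.
End FixedDegree.
End WordCounts.

Theorem theorem2p5p7
    (p : nat) (F : fieldType) (hp : p \in [pchar F])
    (G : zmodType) (gamma : G -> G -> F)
    (hgamma : bicharacter gamma)
    (hGplus : forall g : G, gamma g g = 1)
    (Lam : addSemigroupType)
    (hLam_countable : countable [set: Lam])
    (hLam : finitely_decomposable Lam)
    (X : choiceType) (degG : X -> G) (degL : X -> Lam)
    (hX : forall l : Lam, finite_set [set x | degL x = l])
    (L : colorLieP p gamma) (iota : X -> L)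
    (hfree : is_free degG iota)
    (V : Lam -> set L)
    (hV : is_Lam_grading iota degL V) :
  (forall l : Lam, finite_dim (V l)) /\
  ch_grading V =
    (fun l => - \sum_(n \in [set n : nat | (0 < n)%N])
        ((moebius_p p n)%:~R / n%:R * ln1p (- dilation n (ch_set degL)) l)).
Proof.
have p_pr := pcharf_prime hp.
(* The alphabet is countable, hence it can be ordered through an injection
   into the natural numbers. *)
have : countable [set: X].
  have -> : [set: X] = \bigcup_(l in [set: Lam]) [set x | degL x = l].
    by apply/seteqP; split=> // x _; exists (degL x).
  by apply: bigcup_countable => // l _; apply: finite_set_countable.
case/countable_injP => f f_injT.
have f_inj : injective f by move=> x y; apply: f_injT; apply: mem_set.
have dimV l : exists2 N, has_dim (V l) N & N%:R =
    - \sum_(n \in [set n : nat | (0 < n)%N])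
        ((moebius_p p n)%:~R / n%:R * ln1p (- dilation n (ch_set degL)) l).
  have [K hK] := wdeg_size_bound hLam hX l.
  exists (size (basis_index degL f l K p)).
    apply: (graded_has_dim hp hgamma hGplus f_inj hfree hV).
      exact: basis_index_uniq.
    exact: (basis_indexP hLam hX f hK p_pr).
  by rewrite (formula_basis_index hLam hX f_inj hK p_pr).
split=> [l|]; first by have [N hN _] := dimV l; exists N.
apply/funext => l; have [N hN <-] := dimV l.
by rewrite /ch_grading (has_dimE hN).
Qed.
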